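(* Let $\mathbf S$ be a category with finite products and let $\mathscr C$ be an $\mathbf S$-indexed symmetric monoidal category with indexed homotopy coproducts preserved by $\otimes$. If $M\in\mathscr C^A$ is totally dualizable, then $(\pi_A)_!M$ is dualizable in the symmetric monoidal category $\mathscr C^\star$.
   Context: **Indexed categories.** $\star$ is the terminal object of $\mathbf S$, $\pi_A\colon A\to\star$ the unique map and $\Delta_A\colon A\to A\times A$ the diagonal; canonical isomorphisms such as $A\times\star\cong A$ are suppressed. An $\mathbf S$-indexed symmetric monoidal category $\mathscr C$ is a pseudofunctor from $\mathbf S^{\mathrm{op}}$ to the 2-category of symmetric monoidal categories, strong symmetric monoidal functors and monoidal natural transformations; its value at $A$ is $(\mathscr C^A,\otimes_A,I_A)$ and its value at $f\colon A\to B$ is the reindexing functor $f^*\colon\mathscr C^B\to\mathscr C^A$. For $M\in\mathscr C^A$, $N\in\mathscr C^B$ the external product is $M\boxtimes N=(\mathrm{id}_A\times\pi_B)^*M\otimes_{A\times B}(\pi_A\times\mathrm{id}_B)^*N\in\mathscr C^{A\times B}$, and $U=I_\star$. **Indexed homotopy coproducts preserved by $\otimes$** means: each $f^*$ has a left adjoint $f_!$; for each square in a class of commutative squares of $\mathbf S$ called homotopy pullback squares, with top $f\colon A\to B$, left $h\colon A\to C$, right $g\colon B\to D$, bottom $k\colon C\to D$, the Beck-Chevalley morphism $f_!h^*\to f_!h^*k^*k_!\cong f_!f^*g^*k_!\to g^*k_!$ is an isomorphism; and for $f\colon A\to B$, $M\in\mathscr C^B$, $N\in\mathscr C^A$ the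 canonical map $f_!(f^*M\otimes N)\to f_!(f^*M\otimes f^*f_!N)\cong f_!f^*(M\otimes f_!N)\to M\otimes f_!N$ is an isomorphism (equivalently, the canonical maps $(f\times g)_!(M\boxtimes N)\to f_!M\boxtimes g_!N$ are isomorphisms). The class of homotopy pullback squares depends on the situation; it is only assumed to contain the following squares, their transposes, and all squares obtained from these by cartesian product with a fixed object: (a) top $f\times\mathrm{id}_C\colon A\times C\to B\times C$, left $\mathrm{id}_A\times g\colon A\times C\to A\times D$, right $\mathrm{id}_B\times g$, bottom $f\times\mathrm{id}_D$; (b) top and left $\Delta_A\colon A\to A\times A$, right $\mathrm{id}_A\times\Delta_A$, bottom $\Delta_A\times\mathrm{id}_A\colon A\times A\to A\times A\times A$; (c) for $f\colon A\to B$: top $(\mathrm{id}_A,f)\colon A\to A\times B$, left $f\colon A\to B$, right $f\times\mathrm{id}_B$, bottom $\Delta_B$. The square with top and left $\mathrm{id}_A$ and right and bottom $\Delta_A$ is not assumed to belong to it. **The bicategory $\mathscr C/_{\mathbf S}$** has the objects of $\mathbf S$ as 0-cells and hom-categories $\mathscr C/_{\mathbf S}(A,B)=\mathscr C^{A\times B}$. For 1-cells $M\colon A\to B$, $N\colon B\to C$, $M\odot N=(\mathrm{id}_A\times\pi_B\times\mathrm{id}_C)_!(\mathrm{id}_A\times\Delta_B\times\mathrm{id}_C)^*(M\boxtimes N)\colon A\to C$; units are $U_A=(\Delta_A)_!\pi_A^*U\cong(\Delta_A)_!I_A$. The associator identifies both bracketings of a triple composite, via pseudofunctoriality, compatibility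 of $\boxtimes$ with reindexing and pushforward, and Beck-Chevalley for (a), with $(\mathrm{id}_A\times\pi_B\times\pi_C\times\mathrm{id}_D)_!(\mathrm{id}_A\times\Delta_B\times\Delta_C\times\mathrm{id}_D)^*(M\boxtimes N\boxtimes P)$. The right unitor is $M\odot U_B\cong(\mathrm{id}_A\times\pi_B\times\mathrm{id}_B)_!(\mathrm{id}_A\times\Delta_B)_!(\mathrm{id}_A\times\Delta_B)^*(\mathrm{id}_A\times\mathrm{id}_B\times\pi_B)^*(M\boxtimes U)\cong M$, by Beck-Chevalley for (b) and $(\pi\times\mathrm{id})\Delta=\mathrm{id}=(\mathrm{id}\times\pi)\Delta$; the left unitor is analogous. **Duality.** An object $M$ of a symmetric monoidal category is dualizable if there are $M^\bigstar$, $\eta\colon I\to M\otimes M^\bigstar$, $\epsilon\colon M^\bigstar\otimes M\to I$ satisfying the triangle identities. A 1-cell $M\colon R\to S$ of a bicategory is right dualizable if there are a 1-cell $M^\bigstar\colon S\to R$ and 2-cells $\eta\colon U_R\to M\odot M^\bigstar$, $\epsilon\colon M^\bigstar\odot M\to U_S$ satisfying the triangle identities. For $M\in\mathscr C^A$, $\check M\colon\star\to A$ denotes $M$ regarded as a 1-cell of $\mathscr C/_{\mathbf S}$ via $A\cong\star\times A$. $M$ is totally dualizable if $\check M$ is right dualizable in $\mathscr C/_{\mathbf S}$. *)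

(* Defs.v *)
From Stdlib Require Import ssreflect ProofIrrelevance.

Set Implicit Arguments.
Unset Strict Implicit.
Unset Printing Implicit Defensive.

Declare Scope cat_scope.
Local Open Scope cat_scope.
Reserved Notation "a ~> b" (at level 70, no associativity).
Reserved Notation "g ∘ f" (at level 40, left associativity).
Reserved Notation "i ⨾ j" (at level 45, right associativity).
Reserved Notation "A × B" (at level 34, left associativity).
Reserved Notation "x ⊗ y" (at level 36, left associativity).
Reserved Notation "x ⊠ y" (at level 36, left associativity).
Reserved Notation "M ⊙ N" (at level 36, left associativity).
Reserved Notation "f ^*" (at level 1, format "f ^*").

(** * Categories, functors, adjunctions *)

Record Category := {
  ob :> Type;
  hom : ob -> ob -> Type;
  idm : forall a, hom a a;
  comp : forall a b c, hom b c -> hom a b -> hom a c;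
  comp_assoc : forall a b c d (h : hom c d) (g : hom b c) (f : hom a b),
    comp h (comp g f) = comp (comp h g) f;
  comp_idl : forall a b (f : hom a b), comp (idm b) f = f;
  comp_idr : forall a b (f : hom a b), comp f (idm a) = f }.
Arguments idm {_} a.
Arguments comp {_ _ _ _} g f.
Notation "a ~> b" := (hom a b) : cat_scope.
Notation "g ∘ f" := (comp g f) : cat_scope.

Record IsIso (C : Category) (a b : C) (f : a ~> b) := {
  iso_inv : b ~> a;
  iso_invK : iso_inv ∘ f = idm a;
  iso_Kinv : f ∘ iso_inv = idm b }.

Record Iso (C : Category) (a b : C) := {
  fwd :> a ~> b;
  fwd_iso : IsIso fwd }.

Definition bwd (C : Category) (a b : C) (i : Iso a b) : b ~> a :=
  iso_inv (fwd_iso i).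

Lemma bwdK (C : Category) (a b : C) (i : Iso a b) : bwd i ∘ i = idm a.
Proof. exact: iso_invK. Qed.

Lemma fwdK (C : Category) (a b : C) (i : Iso a b) : i ∘ bwd i = idm b.
Proof. exact: iso_Kinv. Qed.

Definition isIso_id (C : Category) (a : C) : IsIso (idm a) :=
  {| iso_inv := idm a; iso_invK := comp_idl (idm a); iso_Kinv := comp_idl (idm a) |}.

Definition iso_id (C : Category) (a : C) : Iso a a := {| fwd_iso := isIso_id a |}.

Definition isIso_inv (C : Category) (a b : C) (f : a ~> b) (H : IsIso f) :
  IsIso (iso_inv H) :=
  {| iso_inv := f; iso_invK := iso_Kinv H; iso_Kinv := iso_invK H |}.

Definition iso_sym (C : Category) (a b : C) (i : Iso a b) : Iso b a :=
  {| fwd_iso := isIso_inv (fwd_iso i) |}.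

Lemma isIso_comp_eqs (C : Category) (a b c : C) (g : b ~> c) (f : a ~> b)
    (G : IsIso g) (F : IsIso f) :
  (iso_inv F ∘ iso_inv G) ∘ (g ∘ f) = idm a
  /\ (g ∘ f) ∘ (iso_inv F ∘ iso_inv G) = idm c.
Proof.
split.
- by rewrite comp_assoc -(comp_assoc (iso_inv F)) iso_invK comp_idr iso_invK.
- by rewrite comp_assoc -(comp_assoc g) iso_Kinv comp_idr iso_Kinv.
Qed.

Definition isIso_comp (C : Category) (a b c : C) (g : b ~> c) (f : a ~> b)
    (G : IsIso g) (F : IsIso f) : IsIso (g ∘ f) :=
  {| iso_inv := iso_inv F ∘ iso_inv G;
     iso_invK := proj1 (isIso_comp_eqs G F);
     iso_Kinv := proj2 (isIso_comp_eqs G F) |}.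

Definition iso_trans (C : Category) (a b c : C) (i : Iso a b) (j : Iso b c) : Iso a c :=
  {| fwd_iso := isIso_comp (fwd_iso j) (fwd_iso i) |}.
Notation "i ⨾ j" := (iso_trans i j) : cat_scope.

(* Transport of [F x] along an equality of indices, as a morphism. *)
Definition transp (X : Type) (C : Category) (F : X -> C) (x y : X) (e : x = y) :
  F x ~> F y :=
  match e in _ = z return F x ~> F z with eq_refl => idm (F x) end.

Definition isIso_transp (X : Type) (C : Category) (F : X -> C) (x y : X) (e : x = y) :
  IsIso (transp F e) :=
  match e in _ = z return IsIso (transp F e) with eq_refl => isIso_id (F x) end.

Definition transp_iso (X : Type) (C : Category) (F : X -> C) (x y : X) (e : x = y) :
  Iso (F x) (F y) := {| fwd_iso := isIso_transp F e |}.

Record Functor (C D : Category) := {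
  fob :> C -> D;
  fmap : forall a b, (a ~> b) -> (fob a ~> fob b);
  fmap_id : forall a, fmap (idm a) = idm (fob a);
  fmap_comp : forall a b c (g : b ~> c) (f : a ~> b),
    fmap (g ∘ f) = fmap g ∘ fmap f }.
Arguments fmap {C D} F {a b} f : rename.

Lemma isIso_fmap_eqs (C D : Category) (F : Functor C D) (a b : C) (f : a ~> b)
    (H : IsIso f) :
  fmap F (iso_inv H) ∘ fmap F f = idm _ /\ fmap F f ∘ fmap F (iso_inv H) = idm _.
Proof. by rewrite -!fmap_comp iso_invK iso_Kinv !fmap_id. Qed.

Definition isIso_fmap (C D : Category) (F : Functor C D) (a b : C) (f : a ~> b)
    (H : IsIso f) : IsIso (fmap F f) :=
  {| iso_inv := fmap F (iso_inv H);
     iso_invK := proj1 (isIso_fmap_eqs F H);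
     iso_Kinv := proj2 (isIso_fmap_eqs F H) |}.

Definition fmap_iso (C D : Category) (F : Functor C D) (a b : C) (i : Iso a b) :
  Iso (F a) (F b) := {| fwd_iso := isIso_fmap F (fwd_iso i) |}.

Record LeftAdjoint (D C : Category) (G : Functor D C) := {
  ladj :> Functor C D;
  adj_unit : forall c, c ~> G (ladj c);
  adj_counit : forall d, ladj (G d) ~> d;
  adj_unit_nat : forall c c' (f : c ~> c'),
    fmap G (fmap ladj f) ∘ adj_unit c = adj_unit c' ∘ f;
  adj_counit_nat : forall d d' (f : d ~> d'),
    f ∘ adj_counit d = adj_counit d' ∘ fmap ladj (fmap G f);
  adj_triangle_l : forall c, adj_counit (ladj c) ∘ fmap ladj (adj_unit c) = idm (ladj c);
  adj_triangle_r : forall d, fmap G (adj_counit d) ∘ adj_unit (G d) = idm (G d) }.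

Definition transpose (D C : Category) (G : Functor D C) (L : LeftAdjoint G)
    (c : C) (d : D) (u : c ~> G d) : L c ~> d :=
  adj_counit L d ∘ fmap L u.

(** * Symmetric monoidal categories and strong symmetric monoidal functors *)

Record SymMonCat := {
  smc_cat :> Category;
  tens : smc_cat -> smc_cat -> smc_cat;
  tensm : forall a a' b b', (a ~> a') -> (b ~> b') -> (tens a b ~> tens a' b');
  munit : smc_cat;
  tassoc : forall a b c, Iso (tens (tens a b) c) (tens a (tens b c));
  tlunit : forall a, Iso (tens munit a) a;
  trunit : forall a, Iso (tens a munit) a;
  tbraid : forall a b, Iso (tens a b) (tens b a);
  tensm_id : forall a b, tensm (idm a) (idm b) = idm (tens a b);
  tensm_comp : forall a a' a'' b b' b''
      (f' : a' ~> a'') (f : a ~> a') (g' : b' ~> b'') (g : b ~> b'),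
    tensm (f' ∘ f) (g' ∘ g) = tensm f' g' ∘ tensm f g;
  tassoc_nat : forall a a' b b' c c' (f : a ~> a') (g : b ~> b') (h : c ~> c'),
    tassoc a' b' c' ∘ tensm (tensm f g) h = tensm f (tensm g h) ∘ tassoc a b c;
  tlunit_nat : forall a a' (f : a ~> a'),
    tlunit a' ∘ tensm (idm munit) f = f ∘ tlunit a;
  trunit_nat : forall a a' (f : a ~> a'),
    trunit a' ∘ tensm f (idm munit) = f ∘ trunit a;
  tbraid_nat : forall a a' b b' (f : a ~> a') (g : b ~> b'),
    tbraid a' b' ∘ tensm f g = tensm g f ∘ tbraid a b;
  tpentagon : forall a b c d,
    tensm (idm a) (tassoc b c d) ∘ tassoc a (tens b c) d ∘ tensm (tassoc a b c) (idm d)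
    = tassoc a b (tens c d) ∘ tassoc (tens a b) c d;
  ttriangle : forall a b,
    tensm (idm a) (tlunit b) ∘ tassoc a munit b = tensm (trunit a) (idm b);
  thexagon : forall a b c,
    tassoc b c a ∘ tbraid a (tens b c) ∘ tassoc a b c
    = tensm (idm b) (tbraid a c) ∘ tassoc b a c ∘ tensm (tbraid a b) (idm c);
  tbraid_sym : forall a b, tbraid b a ∘ tbraid a b = idm (tens a b) }.
Arguments munit {_}.
Notation "x ⊗ y" := (tens x y) : cat_scope.

Lemma isIso_tens_eqs (V : SymMonCat) (a a' b b' : V) (f : a ~> a') (g : b ~> b')
    (F : IsIso f) (G : IsIso g) :
  tensm (iso_inv F) (iso_inv G) ∘ tensm f g = idm _
  /\ tensm f g ∘ tensm (iso_inv F) (iso_inv G) = idm _.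
Proof. by rewrite -!tensm_comp !iso_invK !iso_Kinv !tensm_id. Qed.

Definition isIso_tens (V : SymMonCat) (a a' b b' : V) (f : a ~> a') (g : b ~> b')
    (F : IsIso f) (G : IsIso g) : IsIso (tensm f g) :=
  {| iso_inv := tensm (iso_inv F) (iso_inv G);
     iso_invK := proj1 (isIso_tens_eqs F G);
     iso_Kinv := proj2 (isIso_tens_eqs F G) |}.

Definition tens_iso (V : SymMonCat) (a a' b b' : V) (i : Iso a a') (j : Iso b b') :
  Iso (a ⊗ b) (a' ⊗ b') := {| fwd_iso := isIso_tens (fwd_iso i) (fwd_iso j) |}.

Definition dualizable (V : SymMonCat) (M : V) : Prop :=
  exists (M' : V) (eta : munit ~> M ⊗ M') (eps : M' ⊗ M ~> munit),
    trunit M ∘ tensm (idm M) eps ∘ tassoc M M' M ∘ tensm eta (idm M) ∘ bwd (tlunit M)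
      = idm M
    /\ tlunit M' ∘ tensm eps (idm M') ∘ bwd (tassoc M' M M') ∘ tensm (idm M') eta
         ∘ bwd (trunit M') = idm M'.

Record StrongSymMonFunctor (V W : SymMonCat) := {
  smf :> Functor V W;
  smf_tens : forall a b, Iso (smf a ⊗ smf b) (smf (a ⊗ b));
  smf_unit : Iso munit (smf munit);
  smf_tens_nat : forall a a' b b' (f : a ~> a') (g : b ~> b'),
    smf_tens a' b' ∘ tensm (fmap smf f) (fmap smf g)
    = fmap smf (tensm f g) ∘ smf_tens a b;
  smf_assoc : forall a b c,
    fmap smf (tassoc a b c) ∘ smf_tens (a ⊗ b) c ∘ tensm (smf_tens a b) (idm (smf c))
    = smf_tens a (b ⊗ c) ∘ tensm (idm (smf a)) (smf_tens b c)
        ∘ tassoc (smf a) (smf b) (smf c);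
  smf_lunit : forall a,
    fmap smf (tlunit a) ∘ smf_tens munit a ∘ tensm smf_unit (idm (smf a))
    = tlunit (smf a);
  smf_runit : forall a,
    fmap smf (trunit a) ∘ smf_tens a munit ∘ tensm (idm (smf a)) smf_unit
    = trunit (smf a);
  smf_braid : forall a b,
    fmap smf (tbraid a b) ∘ smf_tens a b = smf_tens b a ∘ tbraid (smf a) (smf b) }.

(** * Categories with finite products *)

Record FinProdCat := {
  fp_cat :> Category;
  term : fp_cat;
  bang : forall A, A ~> term;
  bang_uniq : forall A (f g : A ~> term), f = g;
  prod : fp_cat -> fp_cat -> fp_cat;
  pr1 : forall A B, prod A B ~> A;
  pr2 : forall A B, prod A B ~> B;
  pair : forall X A B, (X ~> A) -> (X ~> B) -> (X ~> prod A B);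
  pr1_pair : forall X A B (f : X ~> A) (g : X ~> B), pr1 A B ∘ pair f g = f;
  pr2_pair : forall X A B (f : X ~> A) (g : X ~> B), pr2 A B ∘ pair f g = g;
  pair_uniq : forall X A B (f g : X ~> prod A B),
    pr1 A B ∘ f = pr1 A B ∘ g -> pr2 A B ∘ f = pr2 A B ∘ g -> f = g }.
Arguments term {_}.
Arguments bang {_} A.
Arguments pr1 {_ A B}.
Arguments pr2 {_ A B}.
Notation "A × B" := (prod A B) : cat_scope.
Notation "⋆" := term : cat_scope.

Definition pmap (S : FinProdCat) (A B C D : S) (f : A ~> B) (g : C ~> D) :
  A × C ~> B × D := pair (f ∘ pr1) (g ∘ pr2).

Definition diag (S : FinProdCat) (A : S) : A ~> A × A := pair (idm A) (idm A).

Definition passoc (S : FinProdCat) (A B C : S) : (A × B) × C ~> A × (B × C) :=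
  pair (pr1 ∘ pr1) (pair (pr2 ∘ pr1) pr2).

Lemma pair_comp (S : FinProdCat) (X Y A B : S) (f : X ~> A) (g : X ~> B) (h : Y ~> X) :
  pair f g ∘ h = pair (f ∘ h) (g ∘ h).
Proof. by apply: pair_uniq; rewrite !comp_assoc !(pr1_pair, pr2_pair). Qed.

Ltac simp_prod :=
  rewrite /pmap /diag /passoc -?comp_assoc;
  repeat (progress rewrite ?pair_comp ?pr1_pair ?pr2_pair ?comp_idl ?comp_idr -?comp_assoc).

(* Decides equalities between maps built from projections, pairings and [bang]. *)
Ltac prod_eq :=
  simp_prod;
  first [ reflexivity
        | exact: bang_uniq
        | apply: pair_uniq; prod_eq ].

(** * Indexed symmetric monoidal categories *)

(* A pseudofunctor from S^op to symmetric monoidal categories, strong symmetric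
   monoidal functors and monoidal transformations.  As S has only identity 2-cells,
   the coherence axioms compare two constraints up to [transp] along an equality of
   morphisms of S. *)
Record IndexedSymMonCat (S : FinProdCat) := {
  fib :> S -> SymMonCat;
  pull : forall A B, (A ~> B) -> StrongSymMonFunctor (fib B) (fib A);
  pull_id : forall A (M : fib A), Iso M (pull (idm A) M);
  pull_comp : forall A B C (f : A ~> B) (g : B ~> C) (M : fib C),
    Iso (pull f (pull g M)) (pull (g ∘ f) M);
  pull_id_nat : forall A (M N : fib A) (u : M ~> N),
    pull_id N ∘ u = fmap (pull (idm A)) u ∘ pull_id M;
  pull_comp_nat : forall A B C (f : A ~> B) (g : B ~> C) (M N : fib C) (u : M ~> N),
    pull_comp f g N ∘ fmap (pull f) (fmap (pull g) u)
    = fmap (pull (g ∘ f)) u ∘ pull_comp f g M;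
  pull_id_tens : forall A (M N : fib A),
    smf_tens (pull (idm A)) M N ∘ tensm (pull_id M) (pull_id N) = pull_id (M ⊗ N);
  pull_id_unit : forall A, smf_unit (pull (idm A)) = pull_id munit :> (_ ~> _);
  pull_comp_tens : forall A B C (f : A ~> B) (g : B ~> C) (M N : fib C),
    pull_comp f g (M ⊗ N) ∘ (fmap (pull f) (smf_tens (pull g) M N)
                               ∘ smf_tens (pull f) (pull g M) (pull g N))
    = smf_tens (pull (g ∘ f)) M N ∘ tensm (pull_comp f g M) (pull_comp f g N);
  pull_comp_unit : forall A B C (f : A ~> B) (g : B ~> C),
    pull_comp f g munit ∘ (fmap (pull f) (smf_unit (pull g)) ∘ smf_unit (pull f))
    = smf_unit (pull (g ∘ f));
  pull_coh_l : forall A B (f : A ~> B) (M : fib B),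
    pull_comp (idm A) f M ∘ pull_id (pull f M)
    = transp (fun h => pull h M) (eq_sym (comp_idr f));
  pull_coh_r : forall A B (f : A ~> B) (M : fib B),
    pull_comp f (idm B) M ∘ fmap (pull f) (pull_id M)
    = transp (fun h => pull h M) (eq_sym (comp_idl f));
  pull_coh_assoc : forall A B C D (f : A ~> B) (g : B ~> C) (h : C ~> D) (M : fib D),
    transp (fun k => pull k M) (comp_assoc h g f)
      ∘ (pull_comp (g ∘ f) h M ∘ pull_comp f g (pull h M))
    = pull_comp f (h ∘ g) M ∘ fmap (pull f) (pull_comp g h M) }.

Section Reindexing.
Variables (S : FinProdCat) (C : IndexedSymMonCat S).
Local Notation "f ^*" := (pull C f) : cat_scope.

Definition pcomp (X Y Z : S) (f : X ~> Y) (g : Y ~> Z) (h : X ~> Z) (e : g ∘ f = h)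
    (M : C Z) : Iso (f^* (g^* M)) (h^* M) :=
  pull_comp f g M ⨾ transp_iso (fun k => k^* M) e.

Definition pid (X : S) (f : X ~> X) (e : idm X = f) (M : C X) : Iso M (f^* M) :=
  pull_id M ⨾ transp_iso (fun k => k^* M) e.

Definition psquare (X Y Z W : S) (f : X ~> Y) (h : X ~> Z) (g : Y ~> W) (k : Z ~> W)
    (e : k ∘ h = g ∘ f) (M : C W) : Iso (h^* (k^* M)) (f^* (g^* M)) :=
  pcomp e M ⨾ iso_sym (pull_comp f g M).

(* The external product. *)
Definition ext (X Y : S) (M : C X) (N : C Y) : C (X × Y) := pr1^* M ⊗ pr2^* N.
Local Notation "M ⊠ N" := (ext M N) : cat_scope.

Definition extm (X Y : S) (M M' : C X) (N N' : C Y) (u : M ~> M') (v : N ~> N') :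
  M ⊠ N ~> M' ⊠ N' := tensm (fmap (pr1^*) u) (fmap (pr2^*) v).

Definition pull_tens (W X Y Z : S) (w : W ~> X) (u : X ~> Y) (v : X ~> Z)
    (u' : W ~> Y) (v' : W ~> Z) (eu : u ∘ w = u') (ev : v ∘ w = v') (M : C Y) (N : C Z) :
  Iso (w^* (u^* M ⊗ v^* N)) (u'^* M ⊗ v'^* N) :=
  iso_sym (smf_tens (w^*) (u^* M) (v^* N)) ⨾ tens_iso (pcomp eu M) (pcomp ev N).

Lemma pr1_pmap (X X' Y Y' : S) (f : X ~> X') (g : Y ~> Y') :
  f ∘ pr1 = pr1 ∘ pmap f g.
Proof. prod_eq. Qed.

Lemma pr2_pmap (X X' Y Y' : S) (f : X ~> X') (g : Y ~> Y') :
  g ∘ pr2 = pr2 ∘ pmap f g.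
Proof. prod_eq. Qed.

Lemma pr2_pmap_id (X X' Y : S) (f : X ~> X') :
  pr2 ∘ pmap f (idm Y) = pr2.
Proof. prod_eq. Qed.

Lemma pr1_id_pmap (X Y Y' : S) (g : Y ~> Y') :
  pr1 ∘ pmap (idm X) g = pr1.
Proof. prod_eq. Qed.

Definition ext_pull_l (X X' Y : S) (f : X ~> X') (M : C X') (N : C Y) :
  Iso (f^* M ⊠ N) ((pmap f (idm Y))^* (M ⊠ N)) :=
  tens_iso (psquare (pr1_pmap f (idm Y)) M) (iso_sym (pcomp (pr2_pmap_id Y f) N))
  ⨾ smf_tens ((pmap f (idm Y))^*) (pr1^* M) (pr2^* N).

Definition ext_pull_r (X Y Y' : S) (g : Y ~> Y') (M : C X) (N : C Y') :
  Iso (M ⊠ g^* N) ((pmap (idm X) g)^* (M ⊠ N)) :=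
  tens_iso (iso_sym (pcomp (pr1_id_pmap X g) M)) (psquare (pr2_pmap (idm X) g) N)
  ⨾ smf_tens ((pmap (idm X) g)^*) (pr1^* M) (pr2^* N).

Lemma passoc1 (X Y Z : S) : pr1 ∘ passoc X Y Z = pr1 ∘ pr1.
Proof. prod_eq. Qed.

Lemma passoc2 (X Y Z : S) : pr2 ∘ passoc X Y Z = pair (pr2 ∘ pr1) pr2.
Proof. prod_eq. Qed.

Definition ext_assoc (X Y Z : S) (M : C X) (N : C Y) (P : C Z) :
  Iso ((M ⊠ N) ⊠ P) ((passoc X Y Z)^* (M ⊠ (N ⊠ P))) :=
  tens_iso (pull_tens (eq_refl (pr1 ∘ pr1)) (eq_refl (pr2 ∘ pr1)) M N) (iso_id _)
  ⨾ tassoc _ _ _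
  ⨾ tens_iso (iso_id _)
      (iso_sym (pull_tens (pr1_pair (pr2 ∘ pr1) pr2) (pr2_pair (pr2 ∘ pr1) pr2) N P))
  ⨾ iso_sym (tens_iso (pcomp (passoc1 X Y Z) M) (pcomp (passoc2 X Y Z) (N ⊠ P)))
  ⨾ smf_tens ((passoc X Y Z)^*) (pr1^* M) (pr2^* (N ⊠ P)).

(* For [e = (bang, id) : X -> ⋆ × X], the isomorphism [e^* (U ⊠ M) ≅ M]; similarly
   [ext_unit_r]. *)
Definition ext_unit_l (X : S) (M : C X) :
  Iso ((pair (bang X) (idm X))^* ((munit : C ⋆) ⊠ M)) M :=
  pull_tens (pr1_pair _ _) (pr2_pair _ _) munit M
  ⨾ tens_iso (iso_sym (smf_unit ((bang X)^*))) (iso_sym (pull_id M))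
  ⨾ tlunit M.

Definition ext_unit_r (X : S) (M : C X) :
  Iso ((pair (idm X) (bang X))^* (M ⊠ (munit : C ⋆))) M :=
  pull_tens (pr1_pair _ _) (pr2_pair _ _) M munit
  ⨾ tens_iso (iso_sym (pull_id M)) (iso_sym (smf_unit ((bang X)^*)))
  ⨾ trunit M.

End Reindexing.

(** * Indexed homotopy coproducts *)

(* The maps of a square are listed in the order top, left, right, bottom.
   Commutativity is required where it is used, in [beck_chevalley]. *)
Definition SquareClass (S : FinProdCat) : Type :=
  forall A B C D : S, (A ~> B) -> (A ~> C) -> (B ~> D) -> (C ~> D) -> Prop.

Inductive basic_square (S : FinProdCat) : SquareClass S :=
| basic_a (A B C D : S) (f : A ~> B) (g : C ~> D) :
    basic_square (pmap f (idm C)) (pmap (idm A) g) (pmap (idm B) g) (pmap f (idm D))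
| basic_b (A : S) :
    basic_square (diag A) (diag A) (pmap (idm A) (diag A))
      (passoc A A A ∘ pmap (diag A) (idm A))
| basic_c (A B : S) (f : A ~> B) :
    basic_square (pair (idm A) f) f (pmap f (idm B)) (diag B).

Inductive basic_square_t (S : FinProdCat) : SquareClass S :=
| basic_t0 (A B C D : S) (f : A ~> B) (h : A ~> C) (g : B ~> D) (k : C ~> D) :
    basic_square f h g k -> basic_square_t f h g k
| basic_t1 (A B C D : S) (f : A ~> B) (h : A ~> C) (g : B ~> D) (k : C ~> D) :
    basic_square f h g k -> basic_square_t h f k g.

(* The squares which every class of homotopy pullback squares has to contain, stated
   for the chosen products only: the version up to canonical isomorphisms is derived
   below ([preserves_iso_square]). The square with two identities and two diagonals is
   not among them. *)
Inductive required_square (S : FinProdCat) : SquareClass S :=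
| required_basic (A B C D : S) (f : A ~> B) (h : A ~> C) (g : B ~> D) (k : C ~> D) :
    basic_square_t f h g k -> required_square f h g k
| required_prod_l (E A B C D : S) (f : A ~> B) (h : A ~> C) (g : B ~> D) (k : C ~> D) :
    basic_square_t f h g k ->
    required_square (pmap (idm E) f) (pmap (idm E) h) (pmap (idm E) g) (pmap (idm E) k)
| required_prod_r (E A B C D : S) (f : A ~> B) (h : A ~> C) (g : B ~> D) (k : C ~> D) :
    basic_square_t f h g k ->
    required_square (pmap f (idm E)) (pmap h (idm E)) (pmap g (idm E)) (pmap k (idm E)).

Section Mates.
Variables (S : FinProdCat) (C : IndexedSymMonCat S).
Variable push : forall (A B : S) (f : A ~> B), LeftAdjoint (pull C f).
Local Notation "f ^*" := (pull C f) : cat_scope.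
Local Notation eta f M := (adj_unit (push f) M).
Local Notation eps f M := (adj_counit (push f) M).

Definition beck_chevalley (X Y Z W : S) (f : X ~> Y) (h : X ~> Z) (g : Y ~> W)
    (k : Z ~> W) (e : k ∘ h = g ∘ f) (M : C Z) :
  push f (h^* M) ~> g^* (push k M) :=
  eps f (g^* (push k M))
  ∘ (fmap (push f) (psquare e (push k M))
     ∘ fmap (push f) (fmap (h^*) (eta k M))).

Definition projection (X Y : S) (f : X ~> Y) (M : C Y) (N : C X) :
  push f (f^* M ⊗ N) ~> M ⊗ push f N :=
  eps f (M ⊗ push f N)
  ∘ (fmap (push f) (smf_tens (f^*) M (push f N))
     ∘ fmap (push f) (tensm (idm (f^* M)) (eta f N))).
End Mates.

Record IndexedHtpyCoproducts (S : FinProdCat) (C : IndexedSymMonCat S) := {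
  push : forall (A B : S) (f : A ~> B), LeftAdjoint (pull C f);
  hpb : SquareClass S;
  hpb_required : forall (X Y Z W : S) (f : X ~> Y) (h : X ~> Z) (g : Y ~> W) (k : Z ~> W),
    required_square f h g k -> hpb f h g k;
  beck_chevalley_iso :
    forall (X Y Z W : S) (f : X ~> Y) (h : X ~> Z) (g : Y ~> W) (k : Z ~> W)
      (e : k ∘ h = g ∘ f) (M : C Z),
    hpb f h g k -> IsIso (beck_chevalley push e M);
  projection_iso : forall (X Y : S) (f : X ~> Y) (M : C Y) (N : C X),
    IsIso (projection push f M N) }.

(** * Universal arrows *)

(* [u : c -> G d] exhibits [d] as the value at [c] of a left adjoint of [G]. *)
Record Universal (D C : Category) (G : Functor D C) (c : C) (d : D) (u : c ~> G d) := {
  un_ext : forall d' : D, (c ~> G d') -> (d ~> d');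
  un_eq : forall (d' : D) (v : c ~> G d'), fmap G (un_ext v) ∘ u = v;
  un_uniq : forall (d' : D) (w w' : d ~> d'),
    fmap G w ∘ u = fmap G w' ∘ u -> w = w' }.

Section UniversalTheory.
Variables (D C : Category) (G : Functor D C) (L : LeftAdjoint G).

Lemma transposeK (c : C) (d : D) (u : c ~> G d) :
  fmap G (transpose L u) ∘ adj_unit L c = u.
Proof.
by rewrite /transpose fmap_comp -comp_assoc adj_unit_nat comp_assoc adj_triangle_r comp_idl.
Qed.

Lemma transpose_inj (c : C) (d : D) (w w' : L c ~> d) :
  fmap G w ∘ adj_unit L c = fmap G w' ∘ adj_unit L c -> w = w'.
Proof.
have tr (v : L c ~> d) : v = adj_counit L d ∘ fmap L (fmap G v ∘ adj_unit L c).
  by rewrite fmap_comp comp_assoc -adj_counit_nat -comp_assoc adj_triangle_l comp_idr.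
by move=> e; rewrite (tr w) (tr w') e.
Qed.

Definition universal_unit (c : C) : Universal (G := G) (adj_unit L c) :=
  {| un_ext := fun d v => transpose L v;
     un_eq := fun d v => transposeK v;
     un_uniq := fun d w w' e => transpose_inj e |}.

Lemma isIso_transpose (c : C) (d : D) (u : c ~> G d) :
  Universal u -> IsIso (transpose L u).
Proof.
move=> U; exists (un_ext U (adj_unit L c)).
- by apply: transpose_inj; rewrite fmap_comp -comp_assoc transposeK un_eq fmap_id comp_idl.
- by apply: (un_uniq U); rewrite fmap_comp -comp_assoc un_eq transposeK fmap_id comp_idl.
Qed.

Lemma universal_transpose (c : C) (d : D) (u : c ~> G d) :
  IsIso (transpose L u) -> Universal u.
Proof.
move=> I; exists (fun d' v => transpose L v ∘ iso_inv I).
- move=> d' v; rewrite -{2}(transposeK u) comp_assoc -fmap_comp -comp_assoc.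
  by rewrite iso_invK comp_idr transposeK.
- move=> d' w w' e.
  have {}e : w ∘ transpose L u = w' ∘ transpose L u.
    apply: transpose_inj.
    by rewrite (fmap_comp G w) (fmap_comp G w') -!comp_assoc transposeK.
  by rewrite -(comp_idr w) -(iso_Kinv I) comp_assoc e -comp_assoc iso_Kinv comp_idr.
Qed.
End UniversalTheory.

Section UniversalClosure.
Variables (D C : Category) (G : Functor D C).

Lemma universal_precomp (c c' : C) (d : D) (u : c ~> G d) (i : c' ~> c) :
  IsIso i -> Universal u -> Universal (u ∘ i).
Proof.
move=> I U; exists (fun d' v => un_ext U (v ∘ iso_inv I)).
- by move=> d' v; rewrite comp_assoc un_eq -comp_assoc iso_invK comp_idr.
- move=> d' w w'; rewrite !comp_assoc => e; apply: (un_uniq U).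
  by rewrite -[LHS]comp_idr -[RHS]comp_idr -(iso_Kinv I) !comp_assoc e.
Qed.

Lemma universal_postcomp (c : C) (d d' : D) (u : c ~> G d) (i : d ~> d') :
  IsIso i -> Universal u -> Universal (fmap G i ∘ u).
Proof.
move=> I U; exists (fun d'' v => un_ext U v ∘ iso_inv I).
- move=> d'' v; rewrite comp_assoc -fmap_comp -comp_assoc iso_invK comp_idr.
  exact: un_eq.
- move=> d'' w w'; rewrite !comp_assoc -!fmap_comp => e.
  have {}e := un_uniq U e.
  by rewrite -(comp_idr w) -(comp_idr w') -(iso_Kinv I) !comp_assoc e.
Qed.

End UniversalClosure.

Lemma bwd_nat (C : Category) (a a' b b' : C) (i : Iso a b) (j : Iso a' b')
    (x : a ~> a') (y : b ~> b') :
  y ∘ i = j ∘ x -> bwd j ∘ y = x ∘ bwd i.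
Proof.
move=> E; rewrite -[LHS]comp_idr -(fwdK i) -comp_assoc (comp_assoc y) E.
by rewrite !comp_assoc bwdK comp_idl.
Qed.

Lemma iso_mono (C : Category) (a b c : C) (i : Iso b c) (x y : a ~> b) :
  i ∘ x = i ∘ y -> x = y.
Proof.
by move=> E; rewrite -[x]comp_idl -[y]comp_idl -(bwdK i) -!comp_assoc E.
Qed.

Lemma assoc_swap (C : Category) (a b c c' d e f : C) (p : e ~> f) (q : d ~> e)
    (r : c ~> d) (s : b ~> c) (t : a ~> b) (r' : c' ~> d) (s' : b ~> c') :
  r ∘ s = r' ∘ s' -> p ∘ q ∘ r ∘ (s ∘ t) = p ∘ (q ∘ r' ∘ (s' ∘ t)).
Proof. by move=> E; rewrite !comp_assoc -(comp_assoc (p ∘ q)) E !comp_assoc. Qed.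

(** * Squares along which universal arrows are preserved *)

Section Squares.
Variables (S : FinProdCat) (C : IndexedSymMonCat S).
Local Notation "f ^*" := (pull C f) : cat_scope.

Lemma pcomp_nat (X Y Z : S) (f : X ~> Y) (g : Y ~> Z) (h : X ~> Z) (e : g ∘ f = h)
    (M N : C Z) (u : M ~> N) :
  pcomp e N ∘ fmap (f^*) (fmap (g^*) u) = fmap (h^*) u ∘ pcomp e M.
Proof. by case: h / e => /=; rewrite !comp_idl pull_comp_nat. Qed.

Lemma pid_nat (X : S) (f : X ~> X) (e : idm X = f) (M N : C X) (u : M ~> N) :
  pid e N ∘ u = fmap (f^*) u ∘ pid e M.
Proof. by case: f / e => /=; rewrite !comp_idl pull_id_nat. Qed.

Lemma pcomp_assoc (X Y Z W : S) (f : X ~> Y) (g : Y ~> Z) (h : Z ~> W)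
    (p : X ~> Z) (q : Y ~> W) (r : X ~> W)
    (e1 : g ∘ f = p) (e2 : h ∘ g = q) (e3 : h ∘ p = r) (e4 : q ∘ f = r) (M : C W) :
  pcomp e3 M ∘ pcomp e1 (h^* M) = pcomp e4 M ∘ fmap (f^*) (pcomp e2 M).
Proof.
case: p / e1 e3 => e3; case: q / e2 e4 => e4; case: r / e4 e3 => e3 /=.
rewrite !comp_idl -pull_coh_assoc (proof_irrelevance _ e3 (comp_assoc h g f)).
by rewrite (@comp_assoc (C X)).
Qed.

Lemma psquare_nat (X Y Z W : S) (f : X ~> Y) (h : X ~> Z) (g : Y ~> W) (k : Z ~> W)
    (e : k ∘ h = g ∘ f) (M N : C W) (u : M ~> N) :
  psquare e N ∘ fmap (h^*) (fmap (k^*) u) = fmap (f^*) (fmap (g^*) u) ∘ psquare e M.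
Proof.
have nat := pull_comp_nat (i := C) f g u.
rewrite /= -comp_assoc; change (transp _ _ ∘ pull_comp h k N) with (fwd (pcomp e N)).
rewrite pcomp_nat.
set P := pcomp e M; change (transp _ _ ∘ pull_comp h k M) with (fwd P).
rewrite comp_assoc comp_assoc; congr (_ ∘ _).
change (bwd (pull_comp f g N) ∘ fmap ((g ∘ f)^*) u
  = fmap (f^*) (fmap (g^*) u) ∘ bwd (pull_comp f g M)).
rewrite -[LHS]comp_idr -(fwdK (pull_comp f g M)).
rewrite -(comp_assoc (bwd (pull_comp f g N))) (comp_assoc (fmap ((g ∘ f)^*) u)) -nat.
by rewrite !comp_assoc bwdK comp_idl.
Qed.

(* Equivalent to invertibility of the Beck-Chevalley morphism, but independent of the
   choice of left adjoints and visibly stable under pasting. *)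
Definition preserves_universal (X Y Z W : S) (f : X ~> Y) (h : X ~> Z) (g : Y ~> W)
    (k : Z ~> W) : Type :=
  forall (e : k ∘ h = g ∘ f) (M : C Z) (N : C W) (u : M ~> k^* N),
  Universal u -> Universal (psquare e N ∘ fmap (h^*) u).

(* It suffices to test one universal arrow out of each object. *)
Record Test (X Y Z W : S) (f : X ~> Y) (h : X ~> Z) (g : Y ~> W) (k : Z ~> W)
    (e : k ∘ h = g ∘ f) (M : C Z) := {
  test_obj : C W;
  test_arr : M ~> k^* test_obj;
  test_univ : Universal test_arr;
  test_pres : Universal (psquare e test_obj ∘ fmap (h^*) test_arr) }.

Lemma isIso_un_ext (D E : Category) (G : Functor D E) (c : E) (d d' : D)
    (u : c ~> G d) (u' : c ~> G d') (U : Universal u) (U' : Universal u') :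
  IsIso (un_ext U u').
Proof.
exists (un_ext U' u).
- by apply: (un_uniq U); rewrite fmap_comp -comp_assoc !un_eq fmap_id comp_idl.
- by apply: (un_uniq U'); rewrite fmap_comp -comp_assoc !un_eq fmap_id comp_idl.
Qed.

Lemma preserves_test (X Y Z W : S) (f : X ~> Y) (h : X ~> Z) (g : Y ~> W) (k : Z ~> W) :
  (forall (e : k ∘ h = g ∘ f) (M : C Z), Test e M) -> preserves_universal f h g k.
Proof.
move=> T e M N u U; have [N0 u0 U0 P0] := T e M.
rewrite -(un_eq U0 u) fmap_comp comp_assoc psquare_nat -comp_assoc.
apply: universal_postcomp => //.
by apply: isIso_fmap; apply: isIso_un_ext.
Qed.

Lemma universal_comp (X Y Z : S) (f : X ~> Y) (g : Y ~> Z) (h : X ~> Z) (e : g ∘ f = h)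
    (M : C X) (N : C Y) (P : C Z) (u : M ~> f^* N) (v : N ~> g^* P) :
  Universal u -> Universal v -> Universal (pcomp e P ∘ (fmap (f^*) v ∘ u)).
Proof.
move=> U V; exists (fun Q w => un_ext V (un_ext U (bwd (pcomp e Q) ∘ w))).
- move=> Q w; rewrite comp_assoc -pcomp_nat -comp_assoc (comp_assoc (fmap (f^*) _)).
  by rewrite -fmap_comp !un_eq comp_assoc fwdK comp_idl.
- move=> Q w w'.
  rewrite (comp_assoc (fmap (h^*) w)) (comp_assoc (fmap (h^*) w')) -(pcomp_nat e w).
  rewrite -(pcomp_nat e w') -!comp_assoc => E.
  have {}E : fmap (f^*) (fmap (g^*) w) ∘ (fmap (f^*) v ∘ u)
             = fmap (f^*) (fmap (g^*) w') ∘ (fmap (f^*) v ∘ u).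
    by rewrite -[LHS]comp_idl -[RHS]comp_idl -(bwdK (pcomp e Q)) -!comp_assoc E.
  move: E; rewrite !comp_assoc -!fmap_comp => E.
  by apply: (un_uniq V); apply: (un_uniq U).
Qed.

Lemma psquare_eq (X Y Z W : S) (f : X ~> Y) (h : X ~> Z) (g : Y ~> W) (k : Z ~> W)
    (m : X ~> W) (e : k ∘ h = g ∘ f) (e1 : k ∘ h = m) (e2 : g ∘ f = m) (M : C W) :
  pcomp e2 M ∘ psquare e M = pcomp e1 M.
Proof.
case: m / e2 e1 => e1; rewrite (proof_irrelevance _ e1 e) /=.
rewrite comp_idl comp_assoc.
change (iso_inv (fwd_iso (pull_comp f g M))) with (bwd (pull_comp f g M)).
by rewrite fwdK comp_idl.
Qed.

Lemma psquare_paste (X Y Z X' Y' Z' : S) (f1 : X ~> Y) (f2 : Y ~> Z) (f : X ~> Z)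
    (k1 : X' ~> Y') (k2 : Y' ~> Z') (k : X' ~> Z') (h : X ~> X') (g : Y ~> Y')
    (l : Z ~> Z') (ef : f2 ∘ f1 = f) (ek : k2 ∘ k1 = k) (e1 : k1 ∘ h = g ∘ f1)
    (e2 : k2 ∘ g = l ∘ f2) (e : k ∘ h = l ∘ f) (N : C Z') :
  psquare e N ∘ fmap (h^*) (pcomp ek N)
  = pcomp ef (l^* N) ∘ fmap (f1^*) (psquare e2 N) ∘ psquare e1 (k2^* N).
Proof.
apply: (iso_mono (i := pcomp (eq_refl (l ∘ f)) N)).
rewrite comp_assoc (psquare_eq e e eq_refl).
have en : k2 ∘ (g ∘ f1) = l ∘ f by rewrite comp_assoc e2 -comp_assoc ef.
rewrite -(pcomp_assoc e1 ek en e).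
have em : (l ∘ f2) ∘ f1 = l ∘ f by rewrite -comp_assoc ef.
rewrite (comp_assoc (pcomp eq_refl N)) (comp_assoc (pcomp eq_refl N)).
rewrite (pcomp_assoc ef (eq_refl (l ∘ f2)) (eq_refl (l ∘ f)) em).
rewrite -(comp_assoc (pcomp em N)) -fmap_comp (psquare_eq e2 e2 eq_refl).
rewrite -(pcomp_assoc (eq_refl (g ∘ f1)) e2 en em) -(comp_assoc (pcomp en N)).
by rewrite (psquare_eq e1 e1 eq_refl).
Qed.

Lemma preserves_paste (X Y Z X' Y' Z' : S) (f1 : X ~> Y) (f2 : Y ~> Z) (f : X ~> Z)
    (k1 : X' ~> Y') (k2 : Y' ~> Z') (k : X' ~> Z') (h : X ~> X') (g : Y ~> Y')
    (l : Z ~> Z') (push : forall (A B : S) (q : A ~> B), LeftAdjoint (q^*)) :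
  f2 ∘ f1 = f -> k2 ∘ k1 = k -> k1 ∘ h = g ∘ f1 -> k2 ∘ g = l ∘ f2 ->
  preserves_universal f1 h g k1 -> preserves_universal f2 g l k2 ->
  preserves_universal f h l k.
Proof.
move=> ef ek e1 e2 P1 P2; apply: preserves_test => e M.
have U1 := universal_unit (push _ _ k1) M.
set u1 := adj_unit _ _ in U1; move: u1 U1; set N1 := ladj _ _ => u1 U1.
have U2 := universal_unit (push _ _ k2) N1.
set u2 := adj_unit _ _ in U2; move: u2 U2; set N2 := ladj _ _ => u2 U2.
exists N2 (pcomp ek N2 ∘ (fmap (k1^*) u2 ∘ u1)); first exact: universal_comp.
suff -> : psquare e N2 ∘ fmap (h^*) (pcomp ek N2 ∘ (fmap (k1^*) u2 ∘ u1))
  = pcomp ef (l^* N2) ∘ (fmap (f1^*) (psquare e2 N2 ∘ fmap (g^*) u2)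
                           ∘ (psquare e1 N1 ∘ fmap (h^*) u1)).
  by apply: universal_comp; [exact: P1 | exact: P2].
rewrite (fmap_comp (h^*) (pcomp ek N2)) (comp_assoc (psquare e N2)).
rewrite (psquare_paste ef ek e1 e2 e) (fmap_comp (h^*) (fmap (k1^*) u2)).
rewrite (fmap_comp (f1^*) (psquare e2 N2)).
exact: assoc_swap (psquare_nat e1 u2).
Qed.

Definition pull_section (X Y : S) (f : X ~> Y) (f' : Y ~> X) (e : f ∘ f' = idm Y)
    (M : C Y) : Iso (f'^* (f^* M)) M :=
  pcomp e M ⨾ iso_sym (pull_id M).

Lemma pull_section_nat (X Y : S) (f : X ~> Y) (f' : Y ~> X) (e : f ∘ f' = idm Y)
    (M N : C Y) (u : M ~> N) :
  pull_section e N ∘ fmap (f'^*) (fmap (f^*) u) = u ∘ pull_section e M.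
Proof.
change (bwd (pull_id N) ∘ pcomp e N ∘ fmap (f'^*) (fmap (f^*) u)
  = u ∘ (bwd (pull_id M) ∘ pcomp e M)).
rewrite -comp_assoc pcomp_nat comp_assoc.
by rewrite (bwd_nat (eq_sym (pull_id_nat u))) comp_assoc.
Qed.

Lemma pull_iso_faithful (X Y : S) (f : X ~> Y) (f' : Y ~> X) (e : f ∘ f' = idm Y)
    (M N : C Y) (u v : M ~> N) :
  fmap (f^*) u = fmap (f^*) v -> u = v.
Proof.
move=> E.
have {}E : u ∘ pull_section e M = v ∘ pull_section e M.
  by rewrite -!pull_section_nat E.
rewrite -(comp_idr u) -(comp_idr v) -(fwdK (pull_section e M)).
by rewrite (comp_assoc u) E -comp_assoc.
Qed.

Lemma universal_iso (X Y : S) (f : X ~> Y) (F : IsIso f) (M : C X) (N : C Y)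
    (u : M ~> f^* N) : IsIso u -> Universal u.
Proof.
move=> U.
have e := iso_Kinv F; have e' := iso_invK F.
pose lift P (v : f^* N ~> f^* P) : N ~> P :=
  pull_section e P ∘ fmap ((iso_inv F)^*) v ∘ bwd (pull_section e N).
have liftK P v : fmap (f^*) (lift P v) = v.
  apply: (pull_iso_faithful e').
  apply: (iso_mono (i := pull_section e P)); rewrite pull_section_nat /lift.
  by rewrite -(comp_assoc _ (bwd _)) bwdK comp_idr.
exists (fun P w => lift P (w ∘ iso_inv U)).
- by move=> P w; rewrite liftK -comp_assoc iso_invK comp_idr.
- move=> P w w' E; apply: (pull_iso_faithful e).
  by rewrite -[LHS]comp_idr -[RHS]comp_idr -(iso_Kinv U) !comp_assoc E.
Qed.

Lemma preserves_iso (X Y Z W : S) (f : X ~> Y) (h : X ~> Z) (g : Y ~> W) (k : Z ~> W) :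
  IsIso f -> IsIso k -> preserves_universal f h g k.
Proof.
move=> F K; apply: preserves_test => e M.
have I : IsIso (bwd (pull_section (iso_invK K) M)) by exact: isIso_inv.
exists ((iso_inv K)^* M) (bwd (pull_section (iso_invK K) M)).
- exact: universal_iso.
- apply: universal_iso => //; apply: isIso_comp; first exact: fwd_iso.
  exact: isIso_fmap.
Qed.

(* A square isomorphic to one with the Beck-Chevalley property has it too. This is what
   makes it harmless to suppress associativity and unit isomorphisms of products. *)
Lemma preserves_iso_square (push : forall (A B : S) (q : A ~> B), LeftAdjoint (q^*))
    (X Y Z W X' Y' Z' W' : S) (f : X ~> Y) (h : X ~> Z) (g : Y ~> W) (k : Z ~> W)
    (f' : X' ~> Y') (h' : X' ~> Z') (g' : Y' ~> W') (k' : Z' ~> W')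
    (a : X' ~> X) (b : Y' ~> Y) (c : Z' ~> Z) (d : W' ~> W) :
  IsIso a -> IsIso b -> IsIso c -> IsIso d ->
  f ∘ a = b ∘ f' -> h ∘ a = c ∘ h' -> g ∘ b = d ∘ g' -> k ∘ c = d ∘ k' ->
  k ∘ h = g ∘ f ->
  preserves_universal f h g k -> preserves_universal f' h' g' k'.
Proof.
move=> IA IB IC ID ef eh eg ek e P.
have Q : preserves_universal (f ∘ a) h' g (k ∘ c).
  exact: (preserves_paste push (eq_refl (f ∘ a)) (eq_refl (k ∘ c)) (eq_sym eh) e
    (preserves_iso (h := h') (g := h) IA IC) P).
have R : preserves_universal (iso_inv IB) g g' (iso_inv ID).
  by apply: preserves_iso; exact: isIso_inv.
apply: (preserves_paste push _ _ _ _ Q R).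
- by rewrite ef comp_assoc iso_invK comp_idl.
- by rewrite ek comp_assoc iso_invK comp_idl.
- by rewrite -comp_assoc -eh !comp_assoc e.
- rewrite -[LHS]comp_idr -(iso_Kinv IB) comp_assoc -(comp_assoc _ _ b) eg.
  by rewrite (comp_assoc (iso_inv ID)) iso_invK comp_idl.
Qed.
End Squares.

(** * Canonical isomorphisms for pushforwards *)

Definition passoc_inv (S : FinProdCat) (A B C : S) : A × (B × C) ~> (A × B) × C :=
  pair (pair pr1 (pr1 ∘ pr2)) (pr2 ∘ pr2).

Lemma isIso_passoc (S : FinProdCat) (A B C : S) : IsIso (passoc A B C).
Proof. by exists (passoc_inv A B C); rewrite /passoc_inv; prod_eq. Qed.

Lemma isIso_passoc_inv (S : FinProdCat) (A B C : S) : IsIso (passoc_inv A B C).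
Proof. by exists (passoc A B C); rewrite /passoc_inv; prod_eq. Qed.

Section Pushforward.
Variables (S : FinProdCat) (C : IndexedSymMonCat S) (H : IndexedHtpyCoproducts C).
Local Notation "f ^*" := (pull C f) : cat_scope.
Local Notation "M ⊠ N" := (ext M N) : cat_scope.
Local Notation eta f M := (adj_unit (push H f) M).

Lemma beck_chevalleyE (X Y Z W : S) (f : X ~> Y) (h : X ~> Z) (g : Y ~> W) (k : Z ~> W)
    (e : k ∘ h = g ∘ f) (M : C Z) :
  beck_chevalley (push H) e M
  = transpose (push H f) (psquare e (push H k M) ∘ fmap (h^*) (eta k M)).
Proof. by rewrite /transpose fmap_comp. Qed.

Lemma projectionE (X Y : S) (f : X ~> Y) (M : C Y) (N : C X) :
  projection (push H) f M N
  = transpose (push H f) (smf_tens (f^*) M (push H f N) ∘ tensm (idm (f^* M)) (eta f N)).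
Proof. by rewrite /transpose fmap_comp. Qed.

Lemma required_preserves (X Y Z W : S) (f : X ~> Y) (h : X ~> Z) (g : Y ~> W)
    (k : Z ~> W) :
  required_square f h g k -> preserves_universal C f h g k.
Proof.
move=> R; apply: preserves_test => e M.
exists (push H k M) (eta k M); first exact: universal_unit.
apply: (universal_transpose (L := push H f)); rewrite -beck_chevalleyE.
by apply: beck_chevalley_iso; exact: hpb_required.
Qed.

Lemma isIso_bc (X Y Z W : S) (f : X ~> Y) (h : X ~> Z) (g : Y ~> W) (k : Z ~> W)
    (P : preserves_universal C f h g k) (e : k ∘ h = g ∘ f) (M : C Z) :
  IsIso (beck_chevalley (push H) e M).
Proof.
rewrite beck_chevalleyE; apply: isIso_transpose; apply: P; exact: universal_unit.
Qed.

Definition bc_iso (X Y Z W : S) (f : X ~> Y) (h : X ~> Z) (g : Y ~> W) (k : Z ~> W)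
    (P : preserves_universal C f h g k) (e : k ∘ h = g ∘ f) (M : C Z) :
  Iso (push H f (h^* M)) (g^* (push H k M)) :=
  {| fwd := beck_chevalley (push H) e M; fwd_iso := isIso_bc P e M |}.

(* [(id)_! ≅ Id] and [(g ∘ f)_! ≅ g_! f_!], the mates of [pull_id] and [pull_comp]. *)
Definition push_id (X : S) (M : C X) : Iso (push H (idm X) M) M :=
  {| fwd := transpose (push H (idm X)) (pull_id M);
     fwd_iso := isIso_transpose _ (universal_iso (isIso_id X) (fwd_iso (pull_id M))) |}.

Definition push_comp (X Y Z : S) (f : X ~> Y) (g : Y ~> Z) (h : X ~> Z) (e : g ∘ f = h)
    (M : C X) : Iso (push H h M) (push H g (push H f M)) :=
  {| fwd := transpose (push H h)
       (pcomp e (push H g (push H f M)) ∘ (fmap (f^*) (eta g (push H f M)) ∘ eta f M));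
     fwd_iso := isIso_transpose _ (universal_comp e (universal_unit (push H f) M)
                  (universal_unit (push H g) (push H f M))) |}.

Lemma universal_tens_r (X Y : S) (f : X ~> Y) (M : C Y) (N : C X) (P : C Y)
    (u : N ~> f^* P) :
  Universal u -> Universal (smf_tens (f^*) M P ∘ tensm (idm (f^* M)) u).
Proof.
move=> U; have U0 := universal_unit (push H f) N.
rewrite -(un_eq U0 u) -{1}(comp_idr (idm (f^* M))) tensm_comp comp_assoc.
rewrite -{1}fmap_id smf_tens_nat -comp_assoc.
apply: universal_postcomp.
- by apply: isIso_tens; [exact: isIso_id | exact: isIso_un_ext].
- by apply: (universal_transpose (L := push H f)); rewrite -projectionE; exact: projection_iso.
Qed.

Lemma universal_tens_l (X Y : S) (f : X ~> Y) (M : C Y) (N : C X) (P : C Y)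
    (u : N ~> f^* P) :
  Universal u -> Universal (smf_tens (f^*) P M ∘ tensm u (idm (f^* M))).
Proof.
move=> U.
have E : smf_tens (f^*) P M ∘ tensm u (idm (f^* M))
   = fmap (f^*) (tbraid M P) ∘ ((smf_tens (f^*) M P ∘ tensm (idm (f^* M)) u)
       ∘ tbraid N (f^* M)).
  rewrite !comp_assoc smf_braid -!comp_assoc; congr (_ ∘ _).
  by rewrite -tbraid_nat !comp_assoc tbraid_sym comp_idl.
rewrite E; apply: universal_postcomp; first exact: fwd_iso.
by apply: universal_precomp; [exact: fwd_iso | exact: universal_tens_r].
Qed.

Lemma preserves_pr1 (X X' Y : S) (f : X ~> X') :
  preserves_universal C (pmap f (idm Y)) pr1 pr1 f.
Proof.
have R := required_preserves (required_basic (basic_t0 (basic_a f (bang Y)))).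
apply: (preserves_iso_square (push H) (a := idm _) (b := idm _)
  (c := pair (idm _) (bang _)) (d := pair (idm _) (bang _)) _ _ _ _ _ _ _ _ _ R);
  try exact: isIso_id; try by prod_eq.
- by exists pr1; prod_eq.
- by exists pr1; prod_eq.
Qed.

Lemma preserves_pr2 (X Y Y' : S) (g : Y ~> Y') :
  preserves_universal C (pmap (idm X) g) pr2 pr2 g.
Proof.
have R := required_preserves (required_basic (basic_t1 (basic_a (bang X) g))).
apply: (preserves_iso_square (push H) (a := idm _) (b := idm _)
  (c := pair (bang _) (idm _)) (d := pair (bang _) (idm _)) _ _ _ _ _ _ _ _ _ R);
  try exact: isIso_id; try by prod_eq.
- by exists pr2; prod_eq.
- by exists pr2; prod_eq.
Qed.

Lemma tensm_split (V : SymMonCat) (a a' b b' c : V) (s : a' ⊗ b' ~> c)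
    (v1 : a ~> a') (i : b ~> b') :
  s ∘ tensm v1 i = (s ∘ tensm v1 (idm b')) ∘ tensm (idm a) i.
Proof. by rewrite -comp_assoc -tensm_comp comp_idr comp_idl. Qed.

Lemma tensm_split' (V : SymMonCat) (a a' b b' c : V) (s : a' ⊗ b' ~> c)
    (i : a ~> a') (v : b ~> b') :
  s ∘ tensm i v = (s ∘ tensm (idm a') v) ∘ tensm i (idm b).
Proof. by rewrite -comp_assoc -tensm_comp comp_idr comp_idl. Qed.

Lemma universal_ext_l (X X' Y : S) (f : X ~> X') (M : C X) (N : C Y) :
  Universal (ext_pull_l f (push H f M) N ∘ extm (eta f M) (idm N)).
Proof.
rewrite /extm fmap_id /= -(comp_assoc (smf_tens _ _ _)) -tensm_comp comp_idr.
rewrite tensm_split; apply: universal_precomp.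
- by apply: isIso_tens; [exact: isIso_id | exact: (fwd_iso (iso_sym (pcomp _ _)))].
- apply: universal_tens_l; apply: (preserves_pr1 (pr1_pmap f (idm Y))).
  exact: universal_unit.
Qed.

Lemma universal_ext_r (X Y Y' : S) (g : Y ~> Y') (M : C X) (N : C Y) :
  Universal (ext_pull_r g M (push H g N) ∘ extm (idm M) (eta g N)).
Proof.
rewrite /extm fmap_id /= -(comp_assoc (smf_tens _ _ _)) -tensm_comp comp_idr.
rewrite tensm_split'; apply: universal_precomp.
- by apply: isIso_tens; [exact: (fwd_iso (iso_sym (pcomp _ _))) | exact: isIso_id].
- apply: universal_tens_r; apply: (preserves_pr2 (pr2_pmap (idm X) g)).
  exact: universal_unit.
Qed.

(* [(f × id)_! (M ⊠ N) ≅ f_! M ⊠ N] and [(id × g)_! (M ⊠ N) ≅ M ⊠ g_! N]. *)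
Definition ext_push_l (X X' Y : S) (f : X ~> X') (M : C X) (N : C Y) :
  Iso (push H (pmap f (idm Y)) (M ⊠ N)) (push H f M ⊠ N) :=
  {| fwd := transpose (push H (pmap f (idm Y)))
              (ext_pull_l f (push H f M) N ∘ extm (eta f M) (idm N));
     fwd_iso := isIso_transpose _ (universal_ext_l f M N) |}.

Definition ext_push_r (X Y Y' : S) (g : Y ~> Y') (M : C X) (N : C Y) :
  Iso (push H (pmap (idm X) g) (M ⊠ N)) (M ⊠ push H g N) :=
  {| fwd := transpose (push H (pmap (idm X) g))
              (ext_pull_r g M (push H g N) ∘ extm (idm M) (eta g N));
     fwd_iso := isIso_transpose _ (universal_ext_r g M N) |}.

End Pushforward.

(** * Bicategories and duality of 1-cells *)

(* The operations of a bicategory, with composition of 1-cells in diagrammatic order.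
   The definition of right dualizability involves only these operations, so the
   bicategory axioms are not recorded. *)
Record BicatData := {
  cell0 :> Type;
  cell1 : cell0 -> cell0 -> Category;
  hcomp : forall R S T, cell1 R S -> cell1 S T -> cell1 R T;
  hcompm : forall R S T (M M' : cell1 R S) (N N' : cell1 S T),
    (M ~> M') -> (N ~> N') -> (hcomp M N ~> hcomp M' N');
  unit1 : forall R, cell1 R R;
  hassoc : forall R S T U (M : cell1 R S) (N : cell1 S T) (P : cell1 T U),
    Iso (hcomp (hcomp M N) P) (hcomp M (hcomp N P));
  hlunit : forall R S (M : cell1 R S), Iso (hcomp (unit1 R) M) M;
  hrunit : forall R S (M : cell1 R S), Iso (hcomp M (unit1 S)) M }.

Definition right_dualizable (B : BicatData) (R S : B) (M : cell1 R S) : Prop :=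
  exists (M' : cell1 S R) (eta : unit1 R ~> hcomp M M') (eps : hcomp M' M ~> unit1 S),
    hrunit M ∘ hcompm (idm M) eps ∘ hassoc M M' M ∘ hcompm eta (idm M) ∘ bwd (hlunit M)
      = idm M
    /\ hlunit M' ∘ hcompm eps (idm M') ∘ bwd (hassoc M' M M') ∘ hcompm (idm M') eta
         ∘ bwd (hrunit M') = idm M'.

(** * The bicategory of an indexed symmetric monoidal category *)

(* [((a, b), c) |-> (a, c)] *)
Definition drop_mid (S : FinProdCat) (A B C : S) : (A × B) × C ~> A × C :=
  pmap pr1 (idm C).

(* [((a, b), c) |-> ((a, b), (b, c))] *)
Definition dup_mid (S : FinProdCat) (A B C : S) : (A × B) × C ~> (A × B) × (B × C) :=
  pair pr1 (pmap pr2 (idm C)).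

Section Composition.
Variables (S : FinProdCat) (C : IndexedSymMonCat S) (H : IndexedHtpyCoproducts C).
Local Notation "f ^*" := (pull C f) : cat_scope.
Local Notation "M ⊠ N" := (ext M N) : cat_scope.

Definition odot (A B D : S) (M : C (A × B)) (N : C (B × D)) : C (A × D) :=
  push H (drop_mid A B D) ((dup_mid A B D)^* (M ⊠ N)).
Local Notation "M ⊙ N" := (odot M N) : cat_scope.

Definition odotm (A B D : S) (M M' : C (A × B)) (N N' : C (B × D))
    (u : M ~> M') (v : N ~> N') : M ⊙ N ~> M' ⊙ N' :=
  fmap (push H (drop_mid A B D)) (fmap ((dup_mid A B D)^*) (extm u v)).

Definition unit_cell (A : S) : C (A × A) :=
  push H (diag A) ((bang A)^* (munit : C ⋆)).

(** ** Associator *)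

(* [(((a, b), c), d) |-> (a, d)] and [(((a, b), c), d) |-> (((a, b), (b, c)), (c, d))];
   the associator compares both bracketings of a triple composite with
   [(drop_mids)_! (dup_mids)^* ((M ⊠ N) ⊠ P)]. *)
Definition drop_mids (A B D E : S) : ((A × B) × D) × E ~> A × E :=
  pmap (pr1 ∘ pr1) (idm E).

Definition dup_mids (A B D E : S) :
    ((A × B) × D) × E ~> ((A × B) × (B × D)) × (D × E) :=
  pair (dup_mid A B D ∘ pr1) (pmap pr2 (idm E)).

Definition triple (A B D E : S) (M : C (A × B)) (N : C (B × D)) (P : C (D × E)) :
    C (A × E) :=
  push H (drop_mids A B D E) ((dup_mids A B D E)^* ((M ⊠ N) ⊠ P)).

Lemma dup_mids_l (A B D E : S) :
  pmap (dup_mid A B D) (idm (D × E)) ∘ dup_mid (A × B) D E = dup_mids A B D E.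
Proof. rewrite /dup_mids /dup_mid; prod_eq. Qed.

Lemma drop_mids_l (A B D E : S) :
  drop_mid A D E ∘ pmap (drop_mid A B D) (idm E) = drop_mids A B D E.
Proof. rewrite /drop_mids /drop_mid; prod_eq. Qed.

Lemma square_l (A B D E : S) :
  pmap (drop_mid A B D) (idm (D × E)) ∘ dup_mid (A × B) D E
  = dup_mid A D E ∘ pmap (drop_mid A B D) (idm E).
Proof. rewrite /drop_mid /dup_mid; prod_eq. Qed.

Lemma preserves_l (A B D E : S) :
  preserves_universal C (pmap (drop_mid A B D) (idm E)) (dup_mid (A × B) D E)
    (dup_mid A D E) (pmap (drop_mid A B D) (idm (D × E))).
Proof.
have R := required_preserves H (required_basic (basic_t0
  (basic_a (pr1 : A × B ~> A) (pair pr1 (idm (D × E)))))).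
apply: (preserves_iso_square (push H) (isIso_passoc (A × B) D E) (isIso_passoc A D E)
  (isIso_passoc (A × B) D (D × E)) (isIso_passoc A D (D × E)) _ _ _ _ _ R);
  rewrite /drop_mid /dup_mid; prod_eq.
Qed.

Definition triple_l (A B D E : S) (M : C (A × B)) (N : C (B × D)) (P : C (D × E)) :
  Iso (triple M N P) ((M ⊙ N) ⊙ P) :=
  fmap_iso (push H (drop_mids A B D E))
    (iso_sym (pcomp (dup_mids_l A B D E) ((M ⊠ N) ⊠ P))
     ⨾ fmap_iso ((dup_mid (A × B) D E)^*)
         (iso_sym (ext_pull_l (dup_mid A B D) (M ⊠ N) P)))
  ⨾ push_comp H (drop_mids_l A B D E) _
  ⨾ fmap_iso (push H (drop_mid A D E))
      (bc_iso H (@preserves_l A B D E) (square_l A B D E) _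
       ⨾ fmap_iso ((dup_mid A D E)^*)
           (ext_push_l H (drop_mid A B D) ((dup_mid A B D)^* (M ⊠ N)) P)).

(* [(((a, b), c), d) |-> ((a, b), ((b, c), d))] *)
Definition dup_first (A B D E : S) : ((A × B) × D) × E ~> (A × B) × ((B × D) × E) :=
  pair (pr1 ∘ pr1) (pmap (pmap pr2 (idm D)) (idm E)).

Lemma dup_mids_r (A B D E : S) :
  passoc (A × B) (B × D) (D × E) ∘ dup_mids A B D E
  = pmap (idm (A × B)) (dup_mid B D E) ∘ dup_first A B D E.
Proof. rewrite /dup_mids /dup_first /dup_mid; prod_eq. Qed.

Lemma drop_mids_r (A B D E : S) :
  drop_mid A B E ∘ pmap pr1 (idm E) = drop_mids A B D E.
Proof. rewrite /drop_mids /drop_mid; prod_eq. Qed.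

Lemma square_r (A B D E : S) :
  pmap (idm (A × B)) (drop_mid B D E) ∘ dup_first A B D E
  = dup_mid A B E ∘ pmap pr1 (idm E).
Proof. rewrite /drop_mid /dup_first /dup_mid; prod_eq. Qed.

Lemma preserves_r (A B D E : S) :
  preserves_universal C (pmap (pr1 : (A × B) × D ~> A × B) (idm E)) (dup_first A B D E)
    (dup_mid A B E) (pmap (idm (A × B)) (drop_mid B D E)).
Proof.
have R := required_preserves H (required_basic (basic_t1
  (basic_a (pair (idm (A × B)) pr2) (pr2 : D × E ~> E)))).
apply: (preserves_iso_square (push H)
  (c := pair (pair pr1 (pr1 ∘ pr1 ∘ pr2)) (pair (pr2 ∘ pr1 ∘ pr2) (pr2 ∘ pr2)))
  (isIso_passoc (A × B) D E) (isIso_id _) _ (isIso_passoc_inv (A × B) B E)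
  _ _ _ _ _ R); rewrite /drop_mid /dup_mid /dup_first /passoc_inv; try by prod_eq.
by exists (pair (pr1 ∘ pr1) (pair (pair (pr2 ∘ pr1) (pr1 ∘ pr2)) (pr2 ∘ pr2))); prod_eq.
Qed.

Definition triple_r (A B D E : S) (M : C (A × B)) (N : C (B × D)) (P : C (D × E)) :
  Iso (triple M N P) (M ⊙ (N ⊙ P)) :=
  fmap_iso (push H (drop_mids A B D E))
    (fmap_iso ((dup_mids A B D E)^*) (ext_assoc M N P)
     ⨾ psquare (dup_mids_r A B D E) (M ⊠ (N ⊠ P))
     ⨾ fmap_iso ((dup_first A B D E)^*)
         (iso_sym (ext_pull_r (dup_mid B D E) M (N ⊠ P))))
  ⨾ push_comp H (drop_mids_r A B D E) _
  ⨾ fmap_iso (push H (drop_mid A B E))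
      (bc_iso H (@preserves_r A B D E) (square_r A B D E) _
       ⨾ fmap_iso ((dup_mid A B E)^*)
           (ext_push_r H (drop_mid B D E) M ((dup_mid B D E)^* (N ⊠ P)))).

Definition odot_assoc (A B D E : S) (M : C (A × B)) (N : C (B × D)) (P : C (D × E)) :
  Iso ((M ⊙ N) ⊙ P) (M ⊙ (N ⊙ P)) :=
  iso_sym (triple_l M N P) ⨾ triple_r M N P.

(** ** Unitors *)

(* [(a, b) |-> ((a, b), b)] *)
Definition dup_r (A B : S) : A × B ~> (A × B) × B := pair (idm (A × B)) pr2.

(* [(a, b) |-> (a, (a, b))] *)
Definition dup_l (A B : S) : A × B ~> A × (A × B) := pair pr1 (idm (A × B)).

Lemma runit_bang (A B : S) :
  pmap (idm (A × B)) (bang B) ∘ dup_r A B = pair (idm (A × B)) (bang (A × B)).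
Proof. rewrite /dup_r; prod_eq. Qed.

Lemma runit_section (A B : S) : drop_mid A B B ∘ dup_r A B = idm (A × B).
Proof. rewrite /drop_mid /dup_r; prod_eq. Qed.

Lemma runit_square (A B : S) :
  pmap (idm (A × B)) (diag B) ∘ dup_r A B = dup_mid A B B ∘ dup_r A B.
Proof. rewrite /dup_mid /dup_r; prod_eq. Qed.

Lemma runit_preserves (A B : S) :
  preserves_universal C (dup_r A B) (dup_r A B) (dup_mid A B B)
    (pmap (idm (A × B)) (diag B)).
Proof.
have R := required_preserves H (required_prod_l A (basic_t1 (basic_b B))).
apply: (preserves_iso_square (push H) (isIso_id _) (isIso_passoc A B B)
  (isIso_passoc A B B) (isIso_passoc A B (B × B)) _ _ _ _ _ R);
  rewrite /dup_mid /dup_r; prod_eq.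
Qed.

Definition odot_runit (A B : S) (M : C (A × B)) : Iso (M ⊙ unit_cell B) M :=
  fmap_iso (push H (drop_mid A B B))
    (fmap_iso ((dup_mid A B B)^*)
       (iso_sym (ext_push_r H (diag B) M ((bang B)^* (munit : C ⋆))))
     ⨾ iso_sym (bc_iso H (@runit_preserves A B) (runit_square A B) _))
  ⨾ iso_sym (push_comp H (runit_section A B) _)
  ⨾ push_id H _
  ⨾ fmap_iso ((dup_r A B)^*) (ext_pull_r (bang B) M (munit : C ⋆))
  ⨾ pcomp (runit_bang A B) (M ⊠ (munit : C ⋆))
  ⨾ ext_unit_r M.

Lemma lunit_bang (A B : S) :
  pmap (bang A) (idm (A × B)) ∘ dup_l A B = pair (bang (A × B)) (idm (A × B)).
Proof. rewrite /dup_l; prod_eq. Qed.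

Lemma lunit_section (A B : S) : drop_mid A A B ∘ pmap (diag A) (idm B) = idm (A × B).
Proof. rewrite /drop_mid; prod_eq. Qed.

Lemma lunit_square (A B : S) :
  pmap (diag A) (idm (A × B)) ∘ dup_l A B = dup_mid A A B ∘ pmap (diag A) (idm B).
Proof. rewrite /dup_mid /dup_l; prod_eq. Qed.

Lemma lunit_preserves (A B : S) :
  preserves_universal C (pmap (diag A) (idm B)) (dup_l A B) (dup_mid A A B)
    (pmap (diag A) (idm (A × B))).
Proof.
have R := required_preserves H (required_prod_r B (basic_t0 (basic_b A))).
apply: (preserves_iso_square (push H)
  (d := pair (pair (pr1 ∘ pr1) (pair (pr2 ∘ pr1) (pr1 ∘ pr2))) (pr2 ∘ pr2))
  (isIso_id _) (isIso_id _) (isIso_passoc_inv A A B) _ _ _ _ _ _ R);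
  rewrite /dup_mid /dup_l /passoc_inv; try by prod_eq.
by exists (pair (pair (pr1 ∘ pr1) (pr1 ∘ pr2 ∘ pr1)) (pair (pr2 ∘ pr2 ∘ pr1) pr2)); prod_eq.
Qed.

Definition odot_lunit (A B : S) (M : C (A × B)) : Iso (unit_cell A ⊙ M) M :=
  fmap_iso (push H (drop_mid A A B))
    (fmap_iso ((dup_mid A A B)^*)
       (iso_sym (ext_push_l H (diag A) ((bang A)^* (munit : C ⋆)) M))
     ⨾ iso_sym (bc_iso H (@lunit_preserves A B) (lunit_square A B) _))
  ⨾ iso_sym (push_comp H (lunit_section A B) _)
  ⨾ push_id H _
  ⨾ fmap_iso ((dup_l A B)^*) (ext_pull_l (bang A) (munit : C ⋆) M)
  ⨾ pcomp (lunit_bang A B) ((munit : C ⋆) ⊠ M)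
  ⨾ ext_unit_l M.

Definition total_bicat : BicatData :=
  {| cell0 := S;
     cell1 := fun A B => C (A × B);
     hcomp := odot;
     hcompm := odotm;
     unit1 := unit_cell;
     hassoc := odot_assoc;
     hlunit := odot_lunit;
     hrunit := odot_runit |}.

(* The identification of [A] with [⋆ × A] is reindexing along the projection. *)
Definition as_cell (A : S) (M : C A) : cell1 (b := total_bicat) ⋆ A :=
  (pr2 : ⋆ × A ~> A)^* M.

Definition totally_dualizable (A : S) (M : C A) : Prop :=
  right_dualizable (as_cell M).

End Composition.

(* Main.v *)
From Stdlib Require Import ssreflect ProofIrrelevance.
Require Import Defs.
Local Open Scope cat_scope.

(** Write [π] for the map from any object of [S] to the terminal object.  The total
    pushforward [π_!], applied to the 1-cells of the bicategory, is an oplax functor to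
    the symmetric monoidal category [C ⋆]: there are maps
    [π_! (X ⊙ Y) ~> π_! X ⊗ π_! Y] and [π_! U_A ~> I] compatible with associators and
    unitors.  An oplax functor does not preserve duals in general, but the one
    comparison that has to be inverted in order to transport a dual pair
    [(X : ⋆ -> A, X' : A -> ⋆)] is the one for [X' ⊙ X], a composite over the terminal
    object, along with [π_! U_⋆ ~> I]; both are invertible, because over the middle
    object [⋆] the horizontal composite is the external product, with which pushforward
    is compatible.  So [π_! X'] is a dual of [π_! X],
    and for [X] the 1-cell of [M] the object [π_! X] is [π_! M].

    These compatibilities can be tested on cocones: a cocone from [X : C A] to [V : C ⋆] is an arrow [X ~> π^* V], and
    [π_! X] is the target of the universal one.  Cocones can be reindexed ([sharp]),
    transposed along a pushforward ([flat]) and tensored ([ten], [box]), hence composed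
    horizontally ([odot_cocone]).  A cocone has its target pulled back along a map to
    the terminal object, and any two such maps are equal, so that reindexing it has no
    dependence on a chosen factorization in [S].  Every
    canonical isomorphism [i] that enters the associator and the unitors is pinned down
    by one equation [w ∘ i = u] between cocones ([carries]), and these equations compose
    along chains of isomorphisms.  This gives [carries_odot_assoc],
    [carries_odot_runit] and [carries_odot_lunit], the oplax coherence laws in
    transposed form.

    With [u], [u'] universal cocones on [X], [X'], the cocone [u' ⊙ u] is again universal
    ([universal_odot_cocone]) and so is the one on the unit of [⋆]
    ([universal_unit_cell_cocone]).  The unit and counit of the dual pair, composed with
    [u ⊙ u'] and with the cocone on [U_A], factor through these two and give the
    coevaluation and evaluation.  Each triangle identity, tested against [u] or [u'],
    becomes the triangle identity of the given dual pair
    ([dualizable_of_right_dualizable]). *)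

Set Implicit Arguments.
Unset Strict Implicit.

Lemma comp_assoc5 (D : Category) (a b c d e f : D) (p : e ~> f) (q : d ~> e)
    (r : c ~> d) (s : b ~> c) (t : a ~> b) :
  p ∘ (q ∘ (r ∘ (s ∘ t))) = p ∘ q ∘ r ∘ s ∘ t.
Proof. by rewrite !comp_assoc. Qed.

(** * Cocones *)

Section Cocones.
Variables (S : FinProdCat) (C : IndexedSymMonCat S).
Local Notation "f ^*" := (pull C f) : cat_scope.
Local Notation "M ⊠ N" := (ext M N) : cat_scope.

Local Notation "X ⇝ V" := (X ~> pull C (bang _) V) (at level 70, no associativity).

Definition post (A : S) (X : C A) (V W : C ⋆) (k : V ~> W) (u : X ⇝ V) : X ⇝ W :=
  fmap ((bang A)^*) k ∘ u.

(** The proof that the composite of [f] with the map to [⋆] is again that map is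
    irrelevant, so that reindexing of cocones needs no equation as an argument. *)
Definition bang_pull (A B : S) (f : A ~> B) (V : C ⋆) :
  Iso (f^* ((bang B)^* V)) ((bang A)^* V) :=
  pcomp (bang_uniq (bang B ∘ f) (bang A)) V.

Definition sharp (A B : S) (f : A ~> B) (X : C B) (V : C ⋆) (u : X ⇝ V) : f^* X ⇝ V :=
  bang_pull f V ∘ fmap (f^*) u.

Definition ten (A : S) (X Y : C A) (V W : C ⋆) (u : X ⇝ V) (v : Y ⇝ W) :
  X ⊗ Y ⇝ V ⊗ W :=
  smf_tens ((bang A)^*) V W ∘ tensm u v.

Definition unit_cocone (A : S) : (munit : C A) ⇝ munit := smf_unit ((bang A)^*).

Definition box (A B : S) (X : C A) (Y : C B) (V W : C ⋆) (u : X ⇝ V) (v : Y ⇝ W) :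
  X ⊠ Y ⇝ V ⊗ W :=
  ten (sharp pr1 u) (sharp pr2 v).

(** The isomorphism [i] identifies [u] with [w].  This is a relation and not an
    equation defining [u], because proofs follow a chain of isomorphisms in either
    direction. *)
Definition carries (A : S) (X Y : C A) (i : Iso X Y) (V : C ⋆) (u : X ⇝ V) (w : Y ⇝ V) :
  Prop := w ∘ fwd i = u.

Lemma carries_id (A : S) (X : C A) (V : C ⋆) (u : X ⇝ V) : carries (iso_id X) u u.
Proof. exact: comp_idr. Qed.

Lemma carries_trans (A : S) (X Y Z : C A) (i : Iso X Y) (j : Iso Y Z) (V : C ⋆)
    (u : X ⇝ V) (w : Y ⇝ V) (z : Z ⇝ V) :
  carries i u w -> carries j w z -> carries (i ⨾ j) u z.
Proof. by move=> <- <-; rewrite /carries comp_assoc. Qed.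

Lemma carries_sym (A : S) (X Y : C A) (i : Iso X Y) (V : C ⋆) (u : X ⇝ V) (w : Y ⇝ V) :
  carries i u w -> carries (iso_sym i) w u.
Proof.
by move=> <-; rewrite /carries -comp_assoc (fwdK i) comp_idr.
Qed.

Lemma post_id (A : S) (X : C A) (V : C ⋆) (u : X ⇝ V) : post (idm V) u = u.
Proof. by rewrite /post fmap_id comp_idl. Qed.

Lemma post_comp (A : S) (X : C A) (V W Z : C ⋆) (l : W ~> Z) (k : V ~> W) (u : X ⇝ V) :
  post (l ∘ k) u = post l (post k u).
Proof. by rewrite /post fmap_comp comp_assoc. Qed.

Lemma post_pre (A : S) (X Y : C A) (x : X ~> Y) (V W : C ⋆) (k : V ~> W) (u : Y ⇝ V) :
  post k (u ∘ x) = post k u ∘ x.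
Proof. exact: comp_assoc. Qed.

Lemma post_chain (A : S) (X Y Z : C A) (x : X ~> Y) (y : Y ~> Z) (V W : C ⋆)
    (k : V ~> W) (u : Y ⇝ V) (w : Z ⇝ W) :
  post k u = w ∘ y -> post k (u ∘ x) = w ∘ (y ∘ x).
Proof. by move=> E; rewrite post_pre E comp_assoc. Qed.

(** For [i] a unitor or associator of 1-cells and [k] the one of [C ⋆], this converts a
    coherence law into the one for the inverses. *)
Lemma carries_bwd (A : S) (X Y : C A) (i : Iso X Y) (V W : C ⋆) (k : Iso V W)
    (u : X ⇝ V) (w : Y ⇝ W) :
  carries i (post k u) w -> post (bwd k) w = u ∘ bwd i.
Proof.
move=> /carries_sym <-.
by rewrite post_pre -post_comp bwdK post_id.
Qed.

Lemma carries_post (A : S) (X Y : C A) (i : Iso X Y) (V W : C ⋆) (k : V ~> W)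
    (u : X ⇝ V) (w : Y ⇝ V) :
  carries i u w -> carries i (post k u) (post k w).
Proof. by move=> <-; rewrite /carries /post comp_assoc. Qed.

(** Coherence isomorphisms of [C ⋆] appear only at one link of a chain; until it is
    reached, [k] is carried along unevaluated. *)
Lemma carries_post_trans (A : S) (X Y Z : C A) (i : Iso X Y) (j : Iso Y Z)
    (V W : C ⋆) (k : V ~> W) (u : X ⇝ V) (w : Y ⇝ V) (z : Z ⇝ W) :
  carries i u w -> carries j (post k w) z -> carries (i ⨾ j) (post k u) z.
Proof. by move=> I; apply: carries_trans; exact: carries_post. Qed.

Lemma sharp_post (A B : S) (f : A ~> B) (X : C B) (V W : C ⋆) (k : V ~> W) (u : X ⇝ V) :
  sharp f (post k u) = post k (sharp f u).
Proof.
rewrite /sharp /post fmap_comp (comp_assoc (bang_pull f W)) /bang_pull pcomp_nat.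
by rewrite -comp_assoc.
Qed.

Lemma ten_post (A : S) (X Y : C A) (V V' W W' : C ⋆) (k : V ~> V') (l : W ~> W')
    (u : X ⇝ V) (v : Y ⇝ W) :
  ten (post k u) (post l v) = post (tensm k l) (ten u v).
Proof. by rewrite /ten /post tensm_comp !comp_assoc smf_tens_nat. Qed.

Lemma sharp_pre (A B : S) (f : A ~> B) (X Y : C B) (x : X ~> Y) (V : C ⋆) (u : Y ⇝ V) :
  sharp f (u ∘ x : X ⇝ V) = sharp f u ∘ fmap (f^*) x.
Proof. by rewrite /sharp fmap_comp comp_assoc. Qed.

Lemma ten_pre (A : S) (X X' Y Y' : C A) (x : X ~> X') (y : Y ~> Y') (V W : C ⋆)
    (u : X' ⇝ V) (v : Y' ⇝ W) :
  ten (u ∘ x : X ⇝ V) (v ∘ y : Y ⇝ W) = ten u v ∘ tensm x y.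
Proof. by rewrite /ten tensm_comp comp_assoc. Qed.

Lemma box_pre (A B : S) (X X' : C A) (Y Y' : C B) (x : X ~> X') (y : Y ~> Y') (V W : C ⋆)
    (u : X' ⇝ V) (v : Y' ⇝ W) :
  box (u ∘ x : X ⇝ V) (v ∘ y : Y ⇝ W) = box u v ∘ extm x y.
Proof. by rewrite /box !sharp_pre ten_pre. Qed.

Lemma box_post (A B : S) (X : C A) (Y : C B) (V V' W W' : C ⋆) (k : V ~> V')
    (l : W ~> W') (u : X ⇝ V) (v : Y ⇝ W) :
  box (post k u) (post l v) = post (tensm k l) (box u v).
Proof. by rewrite /box !sharp_post ten_post. Qed.

(** * Canonical isomorphisms of reindexing and of the tensor product *)

Lemma carries_pull (A B : S) (f : A ~> B) (X Y : C B) (i : Iso X Y) (V : C ⋆)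
    (u : X ⇝ V) (w : Y ⇝ V) :
  carries i u w -> carries (fmap_iso (f^*) i) (sharp f u) (sharp f w).
Proof. by move=> <-; rewrite /carries sharp_pre. Qed.

Lemma carries_tens (A : S) (X X' Y Y' : C A) (i : Iso X X') (j : Iso Y Y') (V W : C ⋆)
    (u : X ⇝ V) (u' : X' ⇝ V) (v : Y ⇝ W) (v' : Y' ⇝ W) :
  carries i u u' -> carries j v v' -> carries (tens_iso i j) (ten u v) (ten u' v').
Proof. by move=> <- <-; rewrite /carries ten_pre. Qed.

(** This is the associativity coherence of the pseudofunctor, applied to
    [f], [g] and the map to [⋆]. *)
Lemma carries_pcomp (X Y Z : S) (f : X ~> Y) (g : Y ~> Z) (h : X ~> Z) (e : g ∘ f = h)
    (M : C Z) (V : C ⋆) (u : M ⇝ V) :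
  carries (pcomp e M) (sharp f (sharp g u)) (sharp h u).
Proof.
rewrite /carries /sharp -comp_assoc -pcomp_nat fmap_comp.
rewrite (comp_assoc (bang_pull h V)) (comp_assoc (bang_pull f V)); congr (_ ∘ _).
exact: pcomp_assoc.
Qed.

(** This is the left unit coherence of the pseudofunctor, up to transport along an
    equation which has to be reflexivity. *)
Lemma carries_pull_id (X : S) (M : C X) (V : C ⋆) (u : M ⇝ V) :
  carries (pull_id M) u (sharp (idm X) u).
Proof.
rewrite /carries /sharp -comp_assoc -pull_id_nat comp_assoc.
suff -> : bang_pull (idm X) V ∘ pull_id ((bang X)^* V) = idm _ by rewrite comp_idl.
rewrite /bang_pull /=.
rewrite -comp_assoc pull_coh_l.
move: (bang_uniq _ _); case: _ / (eq_sym _) => e.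
by rewrite (proof_irrelevance _ e eq_refl) comp_idl.
Qed.

Lemma carries_psquare (X Y Z W : S) (f : X ~> Y) (h : X ~> Z) (g : Y ~> W) (k : Z ~> W)
    (e : k ∘ h = g ∘ f) (M : C W) (V : C ⋆) (u : M ⇝ V) :
  carries (psquare e M) (sharp h (sharp k u)) (sharp f (sharp g u)).
Proof.
apply: carries_trans; first exact: carries_pcomp.
apply: carries_sym.
have := carries_pcomp (eq_refl (g ∘ f)) u.
by rewrite /carries /= comp_idl.
Qed.

Lemma pcomp_tens (X Y Z : S) (f : X ~> Y) (g : Y ~> Z) (h : X ~> Z) (e : g ∘ f = h)
    (M N : C Z) :
  pcomp e (M ⊗ N) ∘ (fmap (f^*) (smf_tens (g^*) M N) ∘ smf_tens (f^*) (g^* M) (g^* N))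
  = smf_tens (h^*) M N ∘ tensm (pcomp e M) (pcomp e N).
Proof. by case: h / e; rewrite /= !comp_idl pull_comp_tens. Qed.

Lemma pcomp_unit (X Y Z : S) (f : X ~> Y) (g : Y ~> Z) (h : X ~> Z) (e : g ∘ f = h) :
  pcomp e munit ∘ (fmap (f^*) (smf_unit (g^*)) ∘ smf_unit (f^*)) = smf_unit (h^*).
Proof. by case: h / e; rewrite /= !comp_idl pull_comp_unit. Qed.

Lemma carries_smf_tens (A B : S) (f : A ~> B) (X Y : C B) (V W : C ⋆)
    (u : X ⇝ V) (v : Y ⇝ W) :
  carries (smf_tens (f^*) X Y) (ten (sharp f u) (sharp f v)) (sharp f (ten u v)).
Proof.
rewrite /carries /sharp /ten tensm_comp fmap_comp.
rewrite [RHS]comp_assoc /bang_pull -pcomp_tens -!comp_assoc; do 2!congr (_ ∘ _).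
by rewrite smf_tens_nat.
Qed.

Lemma carries_smf_unit (A B : S) (f : A ~> B) :
  carries (smf_unit (f^*)) (unit_cocone A) (sharp f (unit_cocone B)).
Proof. by rewrite /carries /sharp -comp_assoc pcomp_unit. Qed.

(** The coherence laws of the strong monoidal functor [π^*] say that associators and
    unitors of a fibre are carried to those of [C ⋆]. *)
Lemma carries_assoc (A : S) (X Y Z : C A) (V W T : C ⋆)
    (u : X ⇝ V) (v : Y ⇝ W) (w : Z ⇝ T) :
  carries (tassoc X Y Z) (post (tassoc V W T) (ten (ten u v) w)) (ten u (ten v w)).
Proof.
rewrite /carries /post /ten.
rewrite -{2}(comp_idl w) -{1}(comp_idl u) !tensm_comp.
rewrite !comp_assoc smf_assoc -!comp_assoc; do 2!congr (_ ∘ _).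
by rewrite tassoc_nat.
Qed.

Lemma carries_lunit (A : S) (X : C A) (V : C ⋆) (u : X ⇝ V) :
  carries (tlunit X) (post (tlunit V) (ten (unit_cocone A) u)) u.
Proof.
rewrite /carries /post /ten /unit_cocone -tlunit_nat -smf_lunit.
by rewrite -!comp_assoc -tensm_comp comp_idl comp_idr.
Qed.

Lemma carries_runit (A : S) (X : C A) (V : C ⋆) (u : X ⇝ V) :
  carries (trunit X) (post (trunit V) (ten u (unit_cocone A))) u.
Proof.
rewrite /carries /post /ten /unit_cocone -trunit_nat -smf_runit.
by rewrite -!comp_assoc -tensm_comp comp_idl comp_idr.
Qed.

Lemma carries_ext_pull_l (A B D : S) (f : A ~> B) (X : C B) (Y : C D) (V W : C ⋆)
    (u : X ⇝ V) (v : Y ⇝ W) :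
  carries (ext_pull_l f X Y) (box (sharp f u) v) (sharp (pmap f (idm D)) (box u v)).
Proof.
apply: carries_trans; last exact: carries_smf_tens.
apply: carries_tens; first exact: carries_psquare.
exact/carries_sym/carries_pcomp.
Qed.

Lemma carries_ext_pull_r (A B D : S) (g : A ~> B) (X : C D) (Y : C B) (V W : C ⋆)
    (u : X ⇝ V) (v : Y ⇝ W) :
  carries (ext_pull_r g X Y) (box u (sharp g v)) (sharp (pmap (idm D) g) (box u v)).
Proof.
apply: carries_trans; last exact: carries_smf_tens.
apply: carries_tens; last exact: carries_psquare.
exact/carries_sym/carries_pcomp.
Qed.

Lemma carries_pull_tens (W X Y Z : S) (w : W ~> X) (p : X ~> Y) (q : X ~> Z)
    (p' : W ~> Y) (q' : W ~> Z) (ep : p ∘ w = p') (eq : q ∘ w = q') (M : C Y) (N : C Z)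
    (V V' : C ⋆) (u : M ⇝ V) (v : N ⇝ V') :
  carries (pull_tens ep eq M N) (sharp w (ten (sharp p u) (sharp q v)))
    (ten (sharp p' u) (sharp q' v)).
Proof.
apply: carries_trans; first exact/carries_sym/carries_smf_tens.
by apply: carries_tens; exact: carries_pcomp.
Qed.

Lemma carries_ext_assoc (A B D : S) (X : C A) (Y : C B) (Z : C D) (V W T : C ⋆)
    (u : X ⇝ V) (v : Y ⇝ W) (w : Z ⇝ T) :
  carries (ext_assoc X Y Z) (post (tassoc V W T) (box (box u v) w))
    (sharp (passoc A B D) (box u (box v w))).
Proof.
apply: carries_post_trans.
  by apply: carries_tens; [exact: carries_pull_tens | exact: carries_id].
apply: carries_trans; first exact: carries_assoc.
apply: carries_trans.
  by apply: carries_tens; [exact: carries_id | exact/carries_sym/carries_pull_tens].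
apply: carries_trans; last exact: carries_smf_tens.
by apply: carries_sym; apply: carries_tens; exact: carries_pcomp.
Qed.

Lemma carries_ext_unit_l (A : S) (X : C A) (V : C ⋆) (u : X ⇝ V) :
  carries (ext_unit_l X)
    (post (tlunit V) (sharp (pair (bang A) (idm A)) (box (unit_cocone ⋆) u))) u.
Proof.
apply: carries_post_trans; first exact: carries_pull_tens.
apply: carries_post_trans; last exact: carries_lunit.
apply: carries_tens; first exact/carries_sym/carries_smf_unit.
exact/carries_sym/carries_pull_id.
Qed.

Lemma carries_ext_unit_r (A : S) (X : C A) (V : C ⋆) (u : X ⇝ V) :
  carries (ext_unit_r X)
    (post (trunit V) (sharp (pair (idm A) (bang A)) (box u (unit_cocone ⋆)))) u.
Proof.
apply: carries_post_trans; first exact: carries_pull_tens.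
apply: carries_post_trans; last exact: carries_runit.
apply: carries_tens; last exact/carries_sym/carries_smf_unit.
exact/carries_sym/carries_pull_id.
Qed.

(** * Cocones on pushforwards *)

Variable H : IndexedHtpyCoproducts C.

(** The bijection between cocones on [X] and on [f_! X] which comes from [f_! ⊣ f^*]
    and [f^* π^* ≅ π^*]. *)
Definition flat (A B : S) (f : A ~> B) (X : C A) (V : C ⋆) (u : X ⇝ V) : push H f X ⇝ V :=
  transpose (push H f) (bwd (bang_pull f V) ∘ u).

Lemma flatK (A B : S) (f : A ~> B) (X : C A) (V : C ⋆) (u : X ⇝ V) :
  sharp f (flat f u) ∘ adj_unit (push H f) X = u.
Proof. by rewrite /sharp -comp_assoc transposeK comp_assoc fwdK comp_idl. Qed.

Lemma flat_uniq (A B : S) (f : A ~> B) (X : C A) (V : C ⋆) (u : X ⇝ V)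
    (w : push H f X ⇝ V) :
  sharp f w ∘ adj_unit (push H f) X = u -> w = flat f u.
Proof.
move=> <-; apply: transpose_inj.
rewrite transposeK /sharp comp_assoc (comp_assoc (bwd (bang_pull f V))) bwdK.
by rewrite comp_idl.
Qed.

(** All canonical isomorphisms out of a pushforward are transposes, so that they are
    determined by precomposing with the unit of the adjunction. *)
Lemma carries_transpose (A B : S) (f : A ~> B) (X : C A) (Y : C B) (x : X ~> f^* Y)
    (V : C ⋆) (u : X ⇝ V) (w : Y ⇝ V) :
  sharp f w ∘ x = u -> w ∘ transpose (push H f) x = flat f u.
Proof.
by move=> <-; apply: flat_uniq; rewrite sharp_pre -comp_assoc transposeK.
Qed.

Lemma flat_post (A B : S) (f : A ~> B) (X : C A) (V W : C ⋆) (k : V ~> W) (u : X ⇝ V) :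
  flat f (post k u) = post k (flat f u).
Proof.
by apply: eq_sym; apply: flat_uniq; rewrite sharp_post /post -comp_assoc flatK.
Qed.

Lemma flat_pre (A B : S) (f : A ~> B) (X Y : C A) (x : X ~> Y) (V : C ⋆) (u : Y ⇝ V) :
  flat f (u ∘ x : X ⇝ V) = flat f u ∘ fmap (push H f) x.
Proof.
apply: eq_sym; apply: flat_uniq.
by rewrite sharp_pre -comp_assoc adj_unit_nat comp_assoc flatK.
Qed.

Lemma carries_push (A B : S) (f : A ~> B) (X Y : C A) (i : Iso X Y) (V : C ⋆)
    (u : X ⇝ V) (w : Y ⇝ V) :
  carries i u w -> carries (fmap_iso (push H f) i) (flat f u) (flat f w).
Proof. by move=> <-; rewrite /carries flat_pre. Qed.

Lemma carries_bc (X Y Z W : S) (f : X ~> Y) (h : X ~> Z) (g : Y ~> W) (k : Z ~> W)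
    (P : preserves_universal C f h g k) (e : k ∘ h = g ∘ f) (M : C Z) (V : C ⋆)
    (u : M ⇝ V) :
  carries (bc_iso H P e M) (flat f (sharp h u)) (sharp g (flat k u)).
Proof.
rewrite /carries /= beck_chevalleyE; apply: carries_transpose.
by rewrite comp_assoc (carries_psquare e) -sharp_pre flatK.
Qed.

Lemma carries_push_id (X : S) (M : C X) (V : C ⋆) (u : M ⇝ V) :
  carries (push_id H M) (flat (idm X) u) u.
Proof. by apply: carries_transpose; exact: carries_pull_id. Qed.

Lemma carries_push_comp (X Y Z : S) (f : X ~> Y) (g : Y ~> Z) (h : X ~> Z)
    (e : g ∘ f = h) (M : C X) (V : C ⋆) (u : M ⇝ V) :
  carries (push_comp H e M) (flat h u) (flat g (flat f u)).
Proof.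
apply: carries_transpose.
by rewrite comp_assoc (carries_pcomp e) comp_assoc -sharp_pre !flatK.
Qed.

Lemma carries_ext_push_l (A B D : S) (f : A ~> B) (X : C A) (Y : C D) (V W : C ⋆)
    (u : X ⇝ V) (v : Y ⇝ W) :
  carries (ext_push_l H f X Y) (flat (pmap f (idm D)) (box u v)) (box (flat f u) v).
Proof.
apply: carries_transpose.
rewrite comp_assoc (carries_ext_pull_l f) -box_pre flatK.
by rewrite comp_idr.
Qed.

Lemma carries_ext_push_r (A B D : S) (g : A ~> B) (X : C D) (Y : C A) (V W : C ⋆)
    (u : X ⇝ V) (v : Y ⇝ W) :
  carries (ext_push_r H g X Y) (flat (pmap (idm D) g) (box u v)) (box u (flat g v)).
Proof.
apply: carries_transpose.
rewrite comp_assoc (carries_ext_pull_r g) -box_pre flatK.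
by rewrite comp_idr.
Qed.

(** * Horizontal composition of cocones *)

(** For universal [u] and [v] this is the transpose of the oplax comparison map
    [π_! (X ⊙ Y) ~> π_! X ⊗ π_! Y]. *)
Definition odot_cocone (A B D : S) (X : C (A × B)) (Y : C (B × D)) (V W : C ⋆)
    (u : X ⇝ V) (v : Y ⇝ W) : odot H X Y ⇝ V ⊗ W :=
  flat (drop_mid A B D) (sharp (dup_mid A B D) (box u v)).

(** The transpose of [π_! U_A ≅ π_! I_A ~> I]. *)
Definition unit_cell_cocone (A : S) : unit_cell H A ⇝ munit :=
  flat (diag A) (sharp (bang A) (unit_cocone ⋆)).

Lemma odot_cocone_pre (A B D : S) (X X' : C (A × B)) (Y Y' : C (B × D))
    (x : X ~> X') (y : Y ~> Y') (V W : C ⋆) (u : X' ⇝ V) (v : Y' ⇝ W) :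
  odot_cocone (u ∘ x : X ⇝ V) (v ∘ y : Y ⇝ W) = odot_cocone u v ∘ odotm H x y.
Proof. by rewrite /odot_cocone box_pre sharp_pre flat_pre. Qed.

Lemma odot_cocone_post (A B D : S) (X : C (A × B)) (Y : C (B × D)) (V V' W W' : C ⋆)
    (k : V ~> V') (l : W ~> W') (u : X ⇝ V) (v : Y ⇝ W) :
  odot_cocone (post k u) (post l v) = post (tensm k l) (odot_cocone u v).
Proof. by rewrite /odot_cocone box_post sharp_post flat_post. Qed.

Lemma carries_triple_l (A B D E : S) (X : C (A × B)) (Y : C (B × D)) (Z : C (D × E))
    (V W T : C ⋆) (u : X ⇝ V) (v : Y ⇝ W) (w : Z ⇝ T) :
  carries (triple_l H X Y Z)
    (flat (drop_mids A B D E) (sharp (dup_mids A B D E) (box (box u v) w)))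
    (odot_cocone (odot_cocone u v) w).
Proof.
apply: carries_trans.
  apply: carries_push; apply: carries_trans; first exact/carries_sym/carries_pcomp.
  exact/carries_pull/carries_sym/carries_ext_pull_l.
apply: carries_trans; first exact: carries_push_comp.
apply: carries_push; apply: carries_trans; first exact: carries_bc.
exact/carries_pull/carries_ext_push_l.
Qed.

Lemma carries_triple_r (A B D E : S) (X : C (A × B)) (Y : C (B × D)) (Z : C (D × E))
    (V W T : C ⋆) (u : X ⇝ V) (v : Y ⇝ W) (w : Z ⇝ T) :
  carries (triple_r H X Y Z)
    (post (tassoc V W T)
      (flat (drop_mids A B D E) (sharp (dup_mids A B D E) (box (box u v) w))))
    (odot_cocone u (odot_cocone v w)).
Proof.
rewrite -flat_post -sharp_post.
apply: carries_trans.
  apply: carries_push; apply: carries_trans; first exact/carries_pull/carries_ext_assoc.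
  apply: carries_trans; first exact: carries_psquare.
  exact/carries_pull/carries_sym/carries_ext_pull_r.
apply: carries_trans; first exact: carries_push_comp.
apply: carries_push; apply: carries_trans; first exact: carries_bc.
exact/carries_pull/carries_ext_push_r.
Qed.

(** Both bracketings of a triple composite of cocones come from the same cocone on
    [triple], up to the associator of [C ⋆]. *)
Lemma carries_odot_assoc (A B D E : S) (X : C (A × B)) (Y : C (B × D)) (Z : C (D × E))
    (V W T : C ⋆) (u : X ⇝ V) (v : Y ⇝ W) (w : Z ⇝ T) :
  carries (odot_assoc H X Y Z)
    (post (tassoc V W T) (odot_cocone (odot_cocone u v) w))
    (odot_cocone u (odot_cocone v w)).
Proof.
apply: carries_trans; last exact: carries_triple_r.
exact/carries_post/carries_sym/carries_triple_l.
Qed.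

Lemma carries_odot_runit (A B : S) (X : C (A × B)) (V : C ⋆) (u : X ⇝ V) :
  carries (odot_runit H X) (post (trunit V) (odot_cocone u (unit_cell_cocone B))) u.
Proof.
apply: carries_post_trans.
  apply: carries_push; apply: carries_trans.
    exact/carries_pull/carries_sym/carries_ext_push_r.
  exact/carries_sym/carries_bc.
apply: carries_post_trans; first exact/carries_sym/carries_push_comp.
apply: carries_post_trans; first exact: carries_push_id.
apply: carries_post_trans; first exact/carries_pull/carries_ext_pull_r.
apply: carries_post_trans; first exact: carries_pcomp.
exact: carries_ext_unit_r.
Qed.

Lemma carries_odot_lunit (A B : S) (X : C (A × B)) (V : C ⋆) (u : X ⇝ V) :
  carries (odot_lunit H X) (post (tlunit V) (odot_cocone (unit_cell_cocone A) u)) u.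
Proof.
apply: carries_post_trans.
  apply: carries_push; apply: carries_trans.
    exact/carries_pull/carries_sym/carries_ext_push_l.
  exact/carries_sym/carries_bc.
apply: carries_post_trans; first exact/carries_sym/carries_push_comp.
apply: carries_post_trans; first exact: carries_push_id.
apply: carries_post_trans; first exact/carries_pull/carries_ext_pull_l.
apply: carries_post_trans; first exact: carries_pcomp.
exact: carries_ext_unit_l.
Qed.

(** * Universal cocones *)

Lemma flat_inj (A B : S) (f : A ~> B) (X : C A) (V : C ⋆) (u v : X ⇝ V) :
  flat f u = flat f v -> u = v.
Proof. by move=> E; rewrite -(flatK f u) E flatK. Qed.

(** An object and its pushforward have the same cocones, so they have the same
    universal ones; likewise, below, for reindexing along an isomorphism. *)
Lemma universal_flat (A B : S) (f : A ~> B) (X : C A) (V : C ⋆) (u : X ⇝ V) :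
  Universal u -> Universal (flat f u).
Proof.
move=> U; exists (fun W w => un_ext U (sharp f w ∘ adj_unit (push H f) X)).
- move=> W w; rewrite -/(post _ _) -flat_post /post un_eq.
  by apply: eq_sym; exact: flat_uniq.
- move=> W k l; rewrite -/(post k _) -/(post l _) -!flat_post => E.
  exact: (un_uniq U (flat_inj E)).
Qed.

(** A universal arrow for [f] followed by one for the map to [⋆] is universal. *)
Lemma universal_of_flat (A B : S) (f : A ~> B) (X : C A) (V : C ⋆) (u : X ⇝ V) :
  Universal (flat f u) -> Universal u.
Proof.
move=> U; rewrite -(flatK f u) /sharp -comp_assoc.
exact: (universal_comp (bang_uniq _ _) (universal_unit (push H f) X) U).
Qed.

(** When [f] is invertible, the identity of [f^* X] exhibits [X] as [f_! f^* X]. *)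
Lemma universal_sharp (A B : S) (f : A ~> B) (X : C B) (V : C ⋆) (u : X ⇝ V) :
  IsIso f -> Universal u -> Universal (sharp f u).
Proof.
move=> F U; rewrite /sharp -(comp_idr (fmap (f^*) u)).
exact: (universal_comp (bang_uniq _ _) (universal_iso F (isIso_id (f^* X))) U).
Qed.

(** Reindexing along an isomorphism is an equivalence, so universality is
    invertibility. *)
Lemma universal_isIso (A B : S) (f : A ~> B) (X : C A) (Y : C B) (u : X ~> f^* Y) :
  IsIso f -> Universal u -> IsIso u.
Proof.
move=> F U.
have I : IsIso (bwd (pull_section (iso_invK F) X)) by exact: isIso_inv.
have U0 := universal_iso F I.
rewrite -(un_eq U0 u); apply: isIso_comp => //.
by apply: isIso_fmap; exact: isIso_un_ext.
Qed.

Lemma isIso_bang_term : IsIso (bang (⋆ : S)).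
Proof. by exists (bang ⋆); exact: bang_uniq. Qed.

Lemma isIso_bang_term2 : IsIso (bang (⋆ × ⋆ : S)).
Proof. by exists (pair (idm _) (idm _)); prod_eq. Qed.

Lemma isIso_sharp (A B : S) (f : A ~> B) (X : C B) (V : C ⋆) (u : X ⇝ V) :
  IsIso u -> IsIso (sharp f u).
Proof. by move=> I; apply: isIso_comp; [exact: fwd_iso | exact: isIso_fmap]. Qed.

Lemma universal_of_carries (A : S) (X Y : C A) (i : Iso X Y) (V : C ⋆) (u : X ⇝ V)
    (w : Y ⇝ V) :
  carries i u w -> Universal w -> Universal u.
Proof. by move=> <- U; apply: universal_precomp => //; exact: fwd_iso. Qed.

(** The external product is compatible with pushforward in each variable, so both
    factors can be pushed forward to [⋆]; there, universal cocones are isomorphisms, and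
    isomorphisms are closed under tensor products. *)
Lemma universal_box (A B : S) (X : C A) (Y : C B) (V W : C ⋆) (u : X ⇝ V) (v : Y ⇝ W) :
  Universal u -> Universal v -> Universal (box u v).
Proof.
move=> U T.
have I := universal_isIso isIso_bang_term (universal_flat (bang A) U).
have J := universal_isIso isIso_bang_term (universal_flat (bang B) T).
apply: (@universal_of_flat _ _ (pmap (bang A) (idm B))).
apply: universal_of_carries (carries_ext_push_l _ _ _) _.
apply: (@universal_of_flat _ _ (pmap (idm ⋆) (bang B))).
apply: universal_of_carries (carries_ext_push_r _ _ _) _.
apply: (universal_iso isIso_bang_term2).
apply: isIso_comp; first exact: fwd_iso.
by apply: isIso_tens; exact: isIso_sharp.
Qed.

(** * Horizontal composites along the terminal object *)

(** Only the point of [⋆] is duplicated; over a general middle object [X ⊙ Y] involves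
    just the restriction of [X ⊠ Y] to a diagonal. *)
Lemma isIso_dup_mid_term (A D : S) : IsIso (dup_mid A ⋆ D).
Proof. by exists (pair pr1 (pr2 ∘ pr2)); rewrite /dup_mid; prod_eq. Qed.

(** The comparison map [π_! (X ⊙ Y) ~> π_! X ⊗ π_! Y] is invertible over the middle
    object [⋆]. *)
Lemma universal_odot_cocone (A D : S) (X : C (A × ⋆)) (Y : C (⋆ × D)) (V W : C ⋆)
    (u : X ⇝ V) (v : Y ⇝ W) :
  Universal u -> Universal v -> Universal (odot_cocone u v).
Proof.
move=> U T; apply: universal_flat; apply: universal_sharp.
- exact: isIso_dup_mid_term.
- exact: universal_box.
Qed.

Lemma universal_unit_cell_cocone : Universal (unit_cell_cocone ⋆).
Proof.
apply: universal_flat; apply: (universal_sharp isIso_bang_term).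
by apply: (universal_iso isIso_bang_term); exact: fwd_iso.
Qed.

(** The object [V] with its universal cocone is [π_! X].  The coevaluation [h] is
    determined by [h · e = (u ⊙ u') ∘ eta], where [e] is the universal cocone on [U_⋆], and
    the evaluation [k] by [k · (u' ⊙ u) = e_A ∘ eps]. *)
Lemma dualizable_of_right_dualizable (A : S) (X : C (⋆ × A)) (V : C ⋆) (u : X ⇝ V) :
  Universal u -> right_dualizable (B := total_bicat H) X -> dualizable (V := C ⋆) V.
Proof.
move=> U [X' [eta [eps [t1 t2]]]].
set V' := push H (bang _) X'.
pose u' : X' ⇝ V' := adj_unit (push H (bang _)) X'.
have U' : Universal u' := universal_unit _ _.
have Uo := universal_odot_cocone U' U.
have Ue := universal_unit_cell_cocone.
pose h := un_ext Ue (odot_cocone u u' ∘ eta).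
pose k := un_ext Uo (unit_cell_cocone A ∘ eps).
have hE : post h (unit_cell_cocone ⋆) = odot_cocone u u' ∘ eta by exact: un_eq.
have kE : post k (odot_cocone u' u) = unit_cell_cocone A ∘ eps by exact: un_eq.
exists V', h, k; split.
-
  (* Each factor of the composite in [C ⋆] is moved past the cocones, from the innermost
     out, and becomes the corresponding factor of the composite of 2-cells. *)
  have e0 := carries_bwd (carries_odot_lunit u).
  have e1 : post (tensm h (idm V)) (odot_cocone (unit_cell_cocone ⋆) u)
      = odot_cocone (odot_cocone u u') u ∘ odotm H eta (idm X).
    by rewrite -odot_cocone_post hE post_id -odot_cocone_pre comp_idr.
  have e2 := eq_sym (carries_odot_assoc u u' u).
  have e3 : post (tensm (idm V) k) (odot_cocone u (odot_cocone u' u))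
      = odot_cocone u (unit_cell_cocone A) ∘ odotm H (idm X) eps.
    by rewrite -odot_cocone_post kE post_id -odot_cocone_pre comp_idr.
  have e4 := eq_sym (carries_odot_runit u).
  apply: (un_uniq U); rewrite -/(post _ u) -/(post (idm V) u) !post_comp post_id.
  rewrite e0 (post_chain _ e1) (post_chain _ e2) (post_chain _ e3) (post_chain _ e4).
  by rewrite (eq_trans (comp_assoc5 _ _ _ _ _) t1) comp_idr.
- have e0 := carries_bwd (carries_odot_runit u').
  have e1 : post (tensm (idm V') h) (odot_cocone u' (unit_cell_cocone ⋆))
      = odot_cocone u' (odot_cocone u u') ∘ odotm H (idm X') eta.
    by rewrite -odot_cocone_post hE post_id -odot_cocone_pre comp_idr.
  have e2 := carries_bwd (carries_odot_assoc u' u u').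
  have e3 : post (tensm k (idm V')) (odot_cocone (odot_cocone u' u) u')
      = odot_cocone (unit_cell_cocone A) u' ∘ odotm H eps (idm X').
    by rewrite -odot_cocone_post kE post_id -odot_cocone_pre comp_idr.
  have e4 := eq_sym (carries_odot_lunit u').
  apply: (un_uniq U'); rewrite -/(post _ u') -/(post (idm V') u') !post_comp post_id.
  rewrite e0 (post_chain _ e1) (post_chain _ e2) (post_chain _ e3) (post_chain _ e4).
  by rewrite (eq_trans (comp_assoc5 _ _ _ _ _) t2) comp_idr.
Qed.

End Cocones.

Unset Implicit Arguments.

Theorem theorem8p1 (S : FinProdCat) (C : IndexedSymMonCat S)
    (H : IndexedHtpyCoproducts C) (A : S) (M : C A) :
  totally_dualizable H M -> dualizable (V := C ⋆) (push H (bang A) M).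
Proof.
apply: dualizable_of_right_dualizable.
(* The 1-cell of [M] is the reindexing of [M] along the invertible
   projection [⋆ × A ~> A]. *)
apply: (universal_sharp (f := pr2)); last exact: universal_unit.
by exists (pair (bang A) (idm A)); prod_eq.
Qed.
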